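(* Let $G$ be a unimodular locally compact (Hausdorff) group with Haar measure $m$, and let $\nu$ be a locally finite (positive Borel) measure on $G$. Then \[ B^-_\nu\le \mathrm{L}^-_\nu\le B^-_\nu \cdot I(G), \qquad I(G)^{-1} \cdot B^+_\nu \le \mathrm{L}^+_\nu \le B^+_\nu . \] In particular, if $G$ is additionally amenable, then $B^-_\nu=\mathrm{L}^-_\nu\le \mathrm{L}^+_\nu= B^+_\nu$.
   Context: A measure means a positive Borel measure; it is locally finite if it is finite on compact sets. Let $\mathcal K$ be the collection of nonempty compact subsets of $G$ and $\mathcal K_p\subseteq\mathcal K$ those of positive Haar measure. For $A,B\subseteq G$, $AB=\{ab: a\in A, b\in B\}$. Leptin's invariant: $I(G)=\sup_{K\in \mathcal K}\inf_{A\in \mathcal K_p} m(KA)/m(A)\in[1,\infty]$. Lower and upper Leptin densities: $\mathrm{L}_\nu^-=\sup_{K\in \mathcal K}\inf_{A\in \mathcal K_p} \nu(KA)/m(A)$, $\mathrm{L}_\nu^+=\inf_{K\in \mathcal K}\sup_{A\in \mathcal K_p} \nu(A)/m(KA)$. Lower and upper Beurling densities: $B^-_\nu=\sup_{A\in\mathcal K_p} \inf_{s\in G} \nu(As)/m(A)$, $B^+_\nu=\inf_{A\in \mathcal K_p}\sup_{s\in G} \nu(As)/m(A)$. Arithmetic is in $[0,\infty]$ with $1/\infty=0$ and $0\cdot\infty=0$. $G$ is amenable if it admits a left-invariant mean on $L^\infty(G)$. *)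

(* Defs.v *)
From HB Require Import structures.
From mathcomp Require Import all_boot all_order all_algebra.
From mathcomp Require Import all_classical all_reals all_analysis.
Set Implicit Arguments. Unset Strict Implicit. Unset Printing Implicit Defensive.
Import Order.TTheory GRing.Theory Num.Theory.
Local Open Scope classical_set_scope.
Local Open Scope ring_scope.

Notation BorelT G := (g_sigma_algebraType (@open G)).

Section LCGroup.
Context {G : ptopologicalType} (mul : G -> G -> G) (inv : G -> G) (e : G).

Definition is_group : Prop :=
  [/\ forall x y z, mul x (mul y z) = mul (mul x y) z,
      forall x, mul e x = x &
      forall x, mul (inv x) x = e].

Definition lc_group : Prop :=
  [/\ is_group,
      continuous (fun p : G * G => mul p.1 p.2),
      continuous inv,
      hausdorff_space G &
      locally_compact [set: G]].

Definition setmul (A B : set G) : set G := [set mul a b | a in A & b in B].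
Definition rtrans (A : set G) (s : G) : set G := [set mul a s | a in A].
Definition ltrans (x : G) (A : set G) : set G := [set mul x a | a in A].

Definition cK : set (set G) := [set K | compact K /\ K !=set0].

Context {R : realType}.
Local Open Scope ereal_scope.

Definition locally_finite (nu : set (BorelT G) -> \bar R) : Prop :=
  forall K : set G, compact K -> nu K < +oo.

Definition haar (m : set (BorelT G) -> \bar R) : Prop :=
  [/\ forall (x : G) (A : set (BorelT G)), measurable A -> m (ltrans x A) = m A,
      locally_finite m,
      forall U : set G, open U -> U !=set0 -> 0 < m U,
      forall A : set (BorelT G), measurable A ->
        m A = ereal_inf [set m U | U in [set U : set G | open U /\ A `<=` U]] &
      forall U : set G, open U ->
        m U = ereal_sup [set m K | K in [set K : set G | compact K /\ K `<=` U]]].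

Definition right_invariant (m : set (BorelT G) -> \bar R) : Prop :=
  forall (x : G) (A : set (BorelT G)), measurable A -> m (rtrans A x) = m A.

Definition cKp (m : set (BorelT G) -> \bar R) : set (set G) :=
  [set A | compact A /\ A !=set0 /\ 0 < m A].

(* a / b for b a positive finite extended real *)
Definition eratio (a b : \bar R) : \bar R := a * ((fine b)^-1)%:E.

Definition leptin_inv (m : set (BorelT G) -> \bar R) : \bar R :=
  ereal_sup [set ereal_inf [set eratio (m (setmul K A)) (m A) | A in cKp m]
            | K in cK].

Definition leptin_lower (m nu : set (BorelT G) -> \bar R) : \bar R :=
  ereal_sup [set ereal_inf [set eratio (nu (setmul K A)) (m A) | A in cKp m]
            | K in cK].

Definition leptin_upper (m nu : set (BorelT G) -> \bar R) : \bar R :=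
  ereal_inf [set ereal_sup [set eratio (nu A) (m (setmul K A)) | A in cKp m]
            | K in cK].

Definition beurling_lower (m nu : set (BorelT G) -> \bar R) : \bar R :=
  ereal_sup [set ereal_inf [set eratio (nu (rtrans A s)) (m A) | s in [set: G]]
            | A in cKp m].

Definition beurling_upper (m nu : set (BorelT G) -> \bar R) : \bar R :=
  ereal_inf [set ereal_sup [set eratio (nu (rtrans A s)) (m A) | s in [set: G]]
            | A in cKp m].

(* amenability: a left-invariant mean on L^oo(G) = L^oo(G, m), where
   functions are identified modulo locally m-null sets *)
Definition locally_null (m : set (BorelT G) -> \bar R) (N : set (BorelT G)) :=
  measurable N /\
  forall B : set (BorelT G), measurable B -> m B < +oo -> m (N `&` B) = 0.

Definition loc_ae (m : set (BorelT G) -> \bar R) (P : G -> Prop) :=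
  exists N, locally_null m N /\ forall x, ~ N x -> P x.

Definition Linf (m : set (BorelT G) -> \bar R) (f : BorelT G -> R) :=
  measurable_fun [set: BorelT G] f /\
  exists C : R, loc_ae m (fun x => (`|f x| <= C)%R).

Definition left_inv_mean (m : set (BorelT G) -> \bar R)
    (M : (BorelT G -> R) -> R) : Prop :=
  [/\ (forall f g, Linf m f -> Linf m g -> loc_ae m (fun x => f x = g x) ->
         M f = M g),
      ((forall f g, Linf m f -> Linf m g -> M (fun x => f x + g x)%R = (M f + M g)%R) /\
       (forall (a : R) f, Linf m f -> M (fun x => a * f x)%R = (a * M f)%R)),
      (forall f, Linf m f -> loc_ae m (fun x => (0 <= f x)%R) -> (0 <= M f)%R),
      M (fun _ => 1%R) = 1%R &
      (forall (x : G) f, Linf m f -> M (fun y => f (mul x y)) = M f)].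

Definition amenable (m : set (BorelT G) -> \bar R) : Prop :=
  exists M, left_inv_mean m M.

End LCGroup.

Definition einv {R : realType} (x : \bar R) : \bar R :=
  match x with
  | r%:E => (r^-1)%:E
  | _ => 0%E
  end.

(* Main.v *)
(** Integrating [nu (A s)] over [s] in a compact set [B] (in discretised form, as
    [nu] need not be regular) gives [B^- <= L^-] with [K = A], and [L^+ <= B^+]
    with [K = A^-1]. For the latter, [A] is first replaced by the support of [m]
    restricted to [A], which is a G_delta by right invariance. The two bounds
    involving [I(G)] follow by translating [K A] and multiplying by
    [m (K A) / m A].

    If [I(G) > 1], then powers of a suitable [K] expand the measure of every
    compact set by arbitrarily large factors. On a maximal [X] with the [U x]
    pairwise disjoint, Hall's theorem then yields [n] injections of [X] with
    disjoint images and bounded displacement. For [Y] in [X] and an invariant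
    mean [M], the functional [A |-> M (sum_(x in Y) 1_(A x))] is left invariant,
    hence comparable with Haar measure; so each of the [n] copies of [X] carries
    a fixed proportion of the mass, which bounds [n]. Thus amenability forces
    [I(G) = 1]. *)
Require Import Defs.
From HB Require Import structures.
From mathcomp Require Import all_boot all_order all_algebra.
From mathcomp Require Import finmap.
From mathcomp Require Import all_classical all_reals all_analysis.
From mathcomp Require Import measurable_realfun ring lra.
Set Implicit Arguments. Unset Strict Implicit. Unset Printing Implicit Defensive.
Import Order.TTheory GRing.Theory Num.Theory.
Local Open Scope classical_set_scope.
Local Open Scope ring_scope.

(** Fubini's theorem is not at hand: [G] is arbitrary, so [m] need not be sigma-finite and the Borel
    sets of [G] x [G] can exceed the product sigma-algebra. Each double integral is replaced by a
    finite sum over small Borel pieces with sample points, at the price of blurring sets by a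
    neighbourhood [V] of [e]. In the lower estimate only a set measured by [m] is blurred, and outer
    regularity lets [V] shrink. In the upper estimate the blurred set is measured by [nu], where
    only continuity from above along a sequence is available; this is why [A] has to be a countable
    intersection of sets [A V n].

    The axioms [averaging] ask for finite sums only, so that they also hold for means, which are not
    countably additive. Applied to [A |-> m (A^-1)], they give [m (A^-1) = m A], which right
    invariance does not state outright.

    Hall's theorem needs finite neighbour sets, hence the net [X] in place of [G]. The mean,
    however, acts on functions on [G], and left translations do not preserve [X]; displacements are
    therefore encoded by sums of indicators of [A_x x], with the translations acting on [A_x]. *)

Lemma open_borel (G : ptopologicalType) (A : set G) : open A -> measurable (A : set (BorelT G)).
Proof. by move=> oA; apply: sub_sigma_algebra. Qed.

Lemma hausdorff_compact_borel (G : ptopologicalType) (A : set G) :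
  hausdorff_space G -> compact A -> measurable (A : set (BorelT G)).
Proof.
by move=> hG /(compact_closed hG)/closed_openC/open_borel/measurableC; rewrite setCK.
Qed.

(** * Finite averages approximating a measure *)

Section DiscreteApprox.
Context {R : realType} {G : ptopologicalType} (m : measure (BorelT G) R).

(** The weights are the measures of disjoint Borel pieces of [S], each inside [O t] for its sample
    point [t], so a sum over [P] is exactly the measure of a union of pieces. The two bounds then
    only ask that the pieces selected by [P] lie in [T], or that they cover it. *)
Lemma discrete_approx (S : set G) (O : G -> set G) :
  hausdorff_space G -> compact S -> (m S < +oo)%E ->
  (forall s, S s -> nbhs s (O s)) ->
  exists l : seq (R * G),
    [/\ forall p, p \in l -> 0 <= p.1 /\ S p.2,
        forall (P : pred G) (T : set G), measurable (T : set (BorelT G)) ->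
          (forall t, S t -> P t -> O t `&` S `<=` T) ->
          ((\sum_(p <- l | P p.2) p.1)%:E <= m T)%E &
        forall (P : pred G) (T : set G), measurable (T : set (BorelT G)) ->
          T `<=` S -> (forall s t, T s -> S t -> O t s -> P t) ->
          (m T <= (\sum_(p <- l | P p.2) p.1)%:E)%E].
Proof.
move=> hG cS mS nO.
have mSS := hausdorff_compact_borel hG cS.
have := cS; rewrite compact_cover => /(_ G S (fun s => (O s)°)) [].
- by move=> i _; exact: open_interior.
- by move=> s Ss; exists s => //; exact: nO.
move=> D DS Scov; set d := enum_fset D.
pose t i := nth point d i.
have St i : (i < size d)%N -> S (t i).
  by move=> id; exact: set_mem (DS _ (mem_nth point id)).
(* The empty sets past the end of the finite cover turn it into a sequence, to which [seqDU]
   applies. *)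
pose F i : set (BorelT G) := if (i < size d)%N then S `&` (O (t i))° else set0.
pose B := seqDU F.
have mF i : measurable (F i).
  rewrite /F; case: ifP => _ //; apply: measurableI => //.
  by apply: open_borel; exact: open_interior.
have mB i : measurable (B i) by exact: seqDU_measurable.
have BF i : B i `<=` F i by exact: subset_seqDU.
have BS i : B i `<=` S.
  by move=> x /BF; rewrite /F; case: ifP => // _ [].
have BO i : B i `<=` O (t i).
  by move=> x /BF; rewrite /F; case: ifP => // _ [_ /interior_subset].
have covB x : S x -> exists2 i, (i < size d)%N & B i x.
  move=> Sx; have [y /= yD Oyx] := Scov _ Sx.
  have : (\bigcup_k F k) x.
    exists (index y d) => //; rewrite /F index_mem; move: (yD) => /= ->.
    by split=> //; rewrite /t nth_index.
  rewrite seqDU_bigcup_eq => -[i _ Bix]; exists i => //.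
  by move/BF: Bix; rewrite /F; case: ifP.
have fB i : m (B i) \is a fin_num.
  by apply/fin_numPlt/andP; split; [exact: lt_le_trans (measure_ge0 _ _)|
    apply: le_lt_trans mS; apply: le_measure; rewrite ?inE].
pose U (P : pred G) := \big[setU/set0]_(i < size d) (if P (t i) then B i else set0).
pose l := [seq (fine (m (B i)), t i) | i <- iota 0 (size d)].
have UP (P : pred G) x : U P x <-> exists i, [/\ (i < size d)%N, P (t i) & B i x].
  rewrite /U -(bigcup_mkord _ (fun i => if P (t i) then B i else set0)).
  split=> [[i /= id]|[i [id Pi Bi]]]; last by exists i => //; rewrite Pi.
  by case: ifP => // Pi Bi; exists i.
have mU P : measurable (U P : set (BorelT G)).
  by apply: bigsetU_measurable => i _; case: ifP.
have sumE (P : pred G) : (\sum_(p <- l | P p.2) p.1)%:E = m (U P).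
  rewrite big_map /= -sumEFin -{1}(subn0 (size d)) -/(index_iota 0 (size d)).
  rewrite big_mkord /U.
  rewrite (@measure_bigsetU _ _ _ m (fun i => if P (t i) then B i else set0)).
  - rewrite big_mkcond /=; apply: eq_bigr => i _.
    by case: ifP => _; rewrite ?measure0// fineK.
  - by move=> i; case: ifP.
  - move=> i j _ _; case: ifP => _; last by move=> [x []].
    by case: ifP => _; [exact: trivIset_seqDU|move=> [x []]].
exists l; split.
- move=> p /mapP[i]; rewrite mem_iota /= add0n => id ->.
  by split; [apply: fine_ge0; exact: measure_ge0|exact: St].
- move=> P T mT PT; rewrite sumE; apply: le_measure; rewrite ?inE//.
  move=> x /UP[i [id Pi Bx]].
  by apply: (PT (t i)) => //; [exact: St|split; [exact: BO|exact: BS Bx]].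
- move=> P T mT TS PT; rewrite sumE; apply: le_measure; rewrite ?inE//.
  move=> x Tx; have [i id Bi] := covB _ (TS _ Tx); apply/UP; exists i; split => //.
  by apply: (PT x) => //; [exact: St|exact: BO].
Qed.

End DiscreteApprox.

Section Averaging.
Context {R : realType} {G : ptopologicalType}.

(* Phi behaves like integration on nonnegative combinations of indicators of
   compact sets; besides measures, this covers the counting means below. *)
Definition averaging (Phi : set G -> R) :=
  [/\ forall A : set G, compact A -> 0 <= Phi A,
      forall (l : seq (R * G)) (C : G -> set G) (A : set G) (c : R),
        (forall p, p \in l -> 0 <= p.1) -> (forall t, compact (C t)) ->
        compact A -> 0 <= c -> (forall p, p \in l -> C p.2 `<=` A) ->
        (forall z, A z -> \sum_(p <- l | `[< C p.2 z >]) p.1 <= c) ->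
        \sum_(p <- l) p.1 * Phi (C p.2) <= c * Phi A &
      forall (l : seq (R * G)) (C : G -> set G) (A : set G) (c : R),
        (forall p, p \in l -> 0 <= p.1) -> (forall t, compact (C t)) ->
        compact A -> 0 <= c ->
        (forall z, A z -> c <= \sum_(p <- l | `[< C p.2 z >]) p.1) ->
        c * Phi A <= \sum_(p <- l) p.1 * Phi (C p.2)].

(** The absolute value does not change the weights in [l], but makes the summand nonnegative for
    every [p], as the integration of a sum requires. *)
Lemma sum_indic (l : seq (R * G)) (C : G -> set G) x :
  (forall p, p \in l -> 0 <= p.1) ->
  (\sum_(p <- l | `[< C p.2 x >]) p.1)%:E =
  (\sum_(p <- l) (`|p.1| * \1_(C p.2 : set (BorelT G)) x)%:E)%E.
Proof.
move=> l0; rewrite sumEFin big_mkcond; congr EFin.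
apply: eq_big_seq => p pl; rewrite ger0_norm ?l0// indicE /=.
by case: asboolP => H; [rewrite mem_set// mulr1|rewrite memNset// mulr0].
Qed.

Lemma measurable_discrete (l : seq (R * G)) (C : G -> set G) :
  (forall p, p \in l -> 0 <= p.1) ->
  (forall t, measurable (C t : set (BorelT G))) ->
  measurable_fun [set: BorelT G]
    (EFin \o (fun x : BorelT G => \sum_(p <- l | `[< C p.2 x >]) p.1)).
Proof.
move=> l0 mC; rewrite /comp; under eq_fun do rewrite sum_indic//.
apply: emeasurable_sum => p; apply/measurable_EFinP; apply: measurable_funM => //.
Qed.

Lemma integral_discrete (mu : measure (BorelT G) R) (l : seq (R * G)) (C : G -> set G) :
  (forall p, p \in l -> 0 <= p.1) ->
  (forall t, measurable (C t : set (BorelT G))) ->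
  (\int[mu]_x (\sum_(p <- l | `[< C p.2 x >]) p.1)%:E =
   \sum_(p <- l) p.1%:E * mu (C p.2))%E.
Proof.
move=> l0 mC; under eq_integral do rewrite sum_indic//.
rewrite ge0_integral_sum//.
- apply: eq_big_seq => p pl.
  rewrite (@integralZl_indic _ _ _ mu _ measurableT (fun=> (C p.2 : set (BorelT G))))//.
    by rewrite integral_indic// setIT ger0_norm ?l0.
  by move=> /lt_geF; rewrite normr_ge0.
- move=> p; apply/measurable_EFinP; apply: measurable_funM => //.
Qed.

Lemma averaging_measure (mu : measure (BorelT G) R) :
  hausdorff_space G -> locally_finite mu -> averaging (fun A => fine (mu A)).
Proof.
move=> hG lf.
have bm (A : set G) : compact A -> measurable (A : set (BorelT G)).
  exact: hausdorff_compact_borel.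
have fm (A : set G) : compact A -> mu A = (fine (mu A))%:E.
  move=> cA; rewrite fineK// ge0_fin_numE ?lf//.
have sE l (C : G -> set G) : (forall t, compact (C t)) ->
    (\sum_(p <- l) p.1 * fine (mu (C p.2)))%:E = (\sum_(p <- l) p.1%:E * mu (C p.2))%E.
  by move=> cC; rewrite -sumEFin; apply: eq_bigr => p _; rewrite EFinM -fm.
have iE (A : set G) c : compact A -> 0 <= c ->
    (c%:E * mu A = \int[mu]_x (c * \1_(A : set (BorelT G)) x)%:E)%E.
  move=> cA c0.
  rewrite (@integralZl_indic _ _ _ mu _ measurableT (fun=> (A : set (BorelT G))))//.
  - by rewrite integral_indic ?setIT//; exact: bm.
  - by move=> /lt_geF; rewrite c0.
  - exact: bm.
split=> [A cA|l C A c l0 cC cA c0 CA le|l C A c l0 cC cA c0 le]; first exact: fine_ge0.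
- rewrite -lee_fin EFinM -fm// sE// -integral_discrete//; last by move=> t; exact: bm.
  rewrite iE//; apply: ge0_le_integral => //.
  + by move=> x _; rewrite lee_fin; rewrite big_seq_cond; apply: sumr_ge0 => p /andP[/l0].
  + by apply: measurable_discrete => // t; exact: bm.
  + apply/measurable_EFinP; apply: measurable_funM => //.
    by apply: measurable_indic; exact: bm.
  + move=> x _; rewrite lee_fin indicE.
    have [xA|/negP xA] := boolP (x \in A); rewrite ?mulr1 ?mulr0.
      by apply: le; exact: set_mem.
    rewrite big_seq_cond big1// => p /andP[pl /asboolP Cx].
    by exfalso; apply: xA; apply/mem_set/(CA _ pl).
- rewrite -lee_fin EFinM -fm// sE// -integral_discrete//; last by move=> t; exact: bm.
  rewrite iE//; apply: ge0_le_integral => //.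
  + by move=> x _; rewrite lee_fin mulr_ge0.
  + apply/measurable_EFinP; apply: measurable_funM => //.
    by apply: measurable_indic; exact: bm.
  + by apply: measurable_discrete => // t; exact: bm.
  + move=> x _; rewrite lee_fin indicE.
    have [xA|/negP xA] := boolP (x \in A); rewrite ?mulr1 ?mulr0.
      by apply: le; exact: set_mem.
    by rewrite big_seq_cond; apply: sumr_ge0 => p /andP[/l0].
Qed.

End Averaging.

(** * Hall's marriage theorem *)

Section Hall.
Context {I V : choiceType}.
Local Open Scope fset_scope.
Implicit Types (N : I -> {fset V}) (J : {fset I}).

Definition nbhd N J : {fset V} := \bigcup_(i <- J) N i.

Lemma nbhdP N J x : reflect (exists2 i, i \in J & x \in N i) (x \in nbhd N J).
Proof.
rewrite /nbhd; apply: (iffP (bigfcupP _ _ _ _)) => [[i /andP[iJ _] xN]|[i iJ xN]]; exists i => //.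
by rewrite iJ.
Qed.

Definition hall N := forall J, (#|` J| <= #|` nbhd N J|)%N.

(** Each [N i] is finite, so at a fixed [i] a member of the chain with the fewest elements there
    already realises the intersection. The Hall condition for [J] involves finitely many [i], and
    comparability yields one member that serves them all. *)
Lemma hall_chain N (A : set {M | hall M /\ forall i, M i `<=` N i}) :
  hall N -> (forall s t, A s -> A t ->
    (forall i, sval s i `<=` sval t i) \/ (forall i, sval t i `<=` sval s i)) ->
  (exists s, A s) ->
  hall (fun i => [fset x in N i | `[< forall s, A s -> x \in sval s i >]]).
Proof.
move=> hN tot [s0 As0]; set M := fun i => _.
have ptw i : exists s, A s /\ sval s i `<=` M i.
  pose P n := `[< exists s, A s /\ #|` sval s i| = n >].
  have exP : exists n, P n by exists #|` sval s0 i|; apply/asboolP; exists s0.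
  case: (ex_minnP exP) => n /asboolP[s [As sn]] nmin; exists s; split => //.
  apply/fsubsetP => x xs; rewrite !inE /=; case: (svalP s) => _ /(_ i)/fsubsetP -> //=.
  apply/asboolP => t At; case: (tot _ _ As At) => [/(_ i)/fsubsetP|/(_ i) ts]; first exact.
  have /eqP -> // : sval t i == sval s i.
  by rewrite eqEfcard ts /= sn; apply: nmin; apply/asboolP; exists t.
have fin (J : seq I) : exists s, A s /\ forall i, i \in J -> sval s i `<=` M i.
  elim: J => [|i J [s [As sJ]]]; first by exists s0.
  have [t [At ti]] := ptw i; case: (tot _ _ As At) => le.
    exists s; split => // j; rewrite inE => /orP[/eqP ->|]; last exact: sJ.
    exact: fsubset_trans (le i) ti.
  exists t; split => // j; rewrite inE => /orP[/eqP -> //|jJ].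
  exact: fsubset_trans (le j) (sJ _ jJ).
move=> J; have [s [As sJ]] := fin (enum_fset J).
have [hs _] := svalP s; apply: leq_trans (hs J) _; apply: fsubset_leq_card.
by apply/fsubsetP => x /nbhdP[i iJ xs]; apply/nbhdP; exists i => //; apply: (fsubsetP (sJ i iJ)).
Qed.

(* Rado's argument: if N i contains a != b, neither of them can be removed, and
   the two violated conditions contradict the submodularity of #|nbhd N J|. *)
Lemma minimal_hall_uniq N : hall N ->
  (forall M, hall M -> (forall i, M i `<=` N i) -> M = N) ->
  forall i a b, a \in N i -> b \in N i -> a = b.
Proof.
move=> hN minN i a b aN bN; apply/eqP/negPn/negP => ab.
have viol c : c \in N i -> exists J, (#|` nbhd N J `|` (N i `\ c)| <= #|` J|)%N /\ i \notin J.
  move=> cN; pose M j := if j == i then N i `\ c else N j.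
  have : ~ hall M.
    move=> hM; have MN : M = N.
      apply: minN => // j; rewrite /M; case: eqP => [->|_]; last exact: fsubset_refl.
      exact: fsubD1set.
    by have := cN; rewrite -MN /M eqxx !inE eqxx.
  move=> /existsNP[J /negP]; rewrite -ltnNge => ltJ.
  have iJ : i \in J.
    apply: contraT => niJ; move: ltJ; rewrite ltnNge => /negP[].
    apply: leq_trans (hN J) _; apply: fsubset_leq_card.
    apply/fsubsetP => x /nbhdP[j jJ xj]; apply/nbhdP; exists j => //.
    by rewrite /M; case: eqP => // ji; move: niJ; rewrite -ji jJ.
  exists (J `\ i); split; last by rewrite !inE eqxx.
  rewrite -ltnS; move: ltJ; rewrite (cardfsD1 i J) iJ add1n; apply: leq_ltn_trans.
  apply: fsubset_leq_card; apply/fsubsetP => x; rewrite inE => /orP[/nbhdP[j]|xN].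
    rewrite !inE => /andP[ji jJ] xj; apply/nbhdP; exists j => //.
    by rewrite /M (negbTE ji).
  by apply/nbhdP; exists i => //; rewrite /M eqxx.
have [A [cA iA]] := viol a aN; have [B [cB iB]] := viol b bN.
have := leq_add cA cB; rewrite -[leqLHS]cardfsUI -[leqRHS]cardfsUI; apply/negP; rewrite -ltnNge.
have -> : (#|` A `|` B| + #|` A `&` B|).+1 = (#|` i |` (A `|` B)| + #|` A `&` B|)%N.
  by rewrite cardfsU1 inE (negbTE iA) (negbTE iB).
apply: leq_add.
  apply: leq_trans (hN _) _; apply: fsubset_leq_card; apply/fsubsetP => x /nbhdP[j].
  rewrite !inE => /or3P[/eqP ->|jA|jB] xj.
  - have [xa|xa] := eqVneq x a; rewrite xj ?orbT//= xa ab !orbT//.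
  - by apply/orP; left; apply/orP; left; apply/nbhdP; exists j.
  - by apply/orP; right; apply/orP; left; apply/nbhdP; exists j.
apply: leq_trans (hN _) _; apply: fsubset_leq_card; apply/fsubsetP => x /nbhdP[j].
rewrite !inE => /andP[jA jB] xj.
by apply/andP; split; apply/orP; left; apply/nbhdP; exists j.
Qed.

(** Zorn's lemma for reversed inclusion gives a minimal Hall family below [N]. Its sets are
    singletons, and the Hall condition for two indices makes these singletons distinct. *)
Theorem hall_marriage N : hall N ->
  exists2 f : I -> V, injective f & forall i, f i \in N i.
Proof.
move=> hN; pose T := {M | hall M /\ forall i, M i `<=` N i}.
pose R (s t : T) := `[< forall i, sval t i `<=` sval s i >].
have [||||s smax] := @Zorn T R.
- by move=> s; apply/asboolP => i; exact: fsubset_refl.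
- move=> r s t /asboolP rs /asboolP st; apply/asboolP => i.
  exact: fsubset_trans (st i) (rs i).
- move=> [s Ps] [t Pt] /asboolP st /asboolP ts; apply: eq_exist; apply/funext => i.
  by apply/eqP; rewrite eqEfsubset (st i) (ts i).
- move=> A tot; have [neA|eA] := pselect (exists s, A s); last first.
    exists (exist _ N (conj hN (fun i => fsubset_refl _))) => s As.
    by exfalso; apply: eA; exists s.
  have hM : hall (fun i => [fset x in N i | `[< forall s, A s -> x \in sval s i >]]).
    apply: hall_chain => // s t As At.
    by case: (tot s t As At) => /asboolP; [right|left].
  have MN i : [fset x in N i | `[< forall s, A s -> x \in sval s i >]] `<=` N i.
    by apply/fsubsetP => x; rewrite !inE => /andP[].
  exists (exist (fun M => hall M /\ forall i, M i `<=` N i) _ (conj hM MN)) => s As; apply/asboolP => i /=.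
  by apply/fsubsetP => x; rewrite !inE => /andP[_ /asboolP]; exact.
case: s smax => M [hM MN] smax.
have uniqM := @minimal_hall_uniq M hM _.
have {}uniqM : forall i a b, a \in M i -> b \in M i -> a = b.
  apply: uniqM => L hL LM.
  have LN i : L i `<=` N i by exact: fsubset_trans (LM i) (MN i).
  by have /(congr1 sval) := smax (exist _ L (conj hL LN)) (asboolT LM).
have /choice[f fM] : forall i, exists x, x \in M i.
  move=> i; have := hM [fset i]; rewrite cardfs1 cardfs_gt0 => /fset0Pn[x /nbhdP[j]].
  by rewrite inE => /eqP -> xM; exists x.
exists f; last by move=> i; apply: (fsubsetP (MN i)).
move=> i j fij; apply/eqP/negPn/negP => ij.
have := hM [fset i; j]; rewrite cardfs2 ij; apply/negP; rewrite -ltnNge ltnS.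
apply: (@leq_trans #|` [fset f i]|); last by rewrite cardfs1.
apply: fsubset_leq_card; apply/fsubsetP => x /nbhdP[k].
rewrite !inE => /orP[/eqP ->|/eqP ->] xM; apply/eqP; first exact: uniqM (fM i).
by rewrite fij; exact: uniqM (fM j).
Qed.

End Hall.

(** * Locally compact groups *)

Section Group.
Context {G : ptopologicalType} {mul : G -> G -> G} {inv : G -> G} {e : G}.
Hypothesis lcG : lc_group mul inv e.
Local Notation "x ⋅ y" := (mul x y) (at level 40, left associativity).
Local Notation "A ⊙ B" := (setmul mul A B) (at level 40, left associativity).
Local Notation ltrans := (ltrans mul).
Local Notation rtrans := (rtrans mul).

Lemma gmulA x y z : x ⋅ y ⋅ z = x ⋅ (y ⋅ z).
Proof. by case: lcG => [[-> _ _]]. Qed.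
Lemma gmul1 x : e ⋅ x = x.
Proof. by case: lcG => [[_ -> _]]. Qed.
Lemma gmulV x : inv x ⋅ x = e.
Proof. by case: lcG => [[_ _ ->]]. Qed.
Lemma gmulKV x y : inv x ⋅ (x ⋅ y) = y.
Proof. by rewrite -gmulA gmulV gmul1. Qed.
Lemma gcancel x y z : x ⋅ y = x ⋅ z -> y = z.
Proof. by move=> /(congr1 (mul (inv x))); rewrite !gmulKV. Qed.
Lemma gmulr1 x : x ⋅ e = x.
Proof. by apply: (@gcancel (inv x)); rewrite gmulKV gmulV. Qed.
Lemma gmulrV x : x ⋅ inv x = e.
Proof. by apply: (@gcancel (inv x)); rewrite gmulKV gmulr1. Qed.
Lemma gmulK x y : x ⋅ (inv x ⋅ y) = y.
Proof. by rewrite -gmulA gmulrV gmul1. Qed.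
Lemma ginvK x : inv (inv x) = x.
Proof. by apply: (@gcancel (inv x)); rewrite gmulrV gmulV. Qed.
Lemma ginvM x y : inv (x ⋅ y) = inv y ⋅ inv x.
Proof. by apply: (@gcancel (x ⋅ y)); rewrite gmulrV gmulA gmulK gmulrV. Qed.
Lemma ginv1 : inv e = e.
Proof. by rewrite -{2}(gmulV e) gmulr1. Qed.

(** The ten rules of the convergent Knuth-Bendix system for groups: rewriting with them decides
    equality of group words. *)
Definition lcg_simp :=
  (ginvM, ginvK, ginv1, gmulA, gmul1, gmulV, gmulKV, gmulr1, gmulrV, gmulK).

Lemma setmulP A B z : (A ⊙ B) z <-> exists a b, [/\ A a, B b & z = a ⋅ b].
Proof.
split=> [[a Aa [b Bb <-]]|[a [b [Aa Bb ->]]]]; first by exists a, b.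
by exists a => //; exists b.
Qed.

Lemma setmul_in A B a b : A a -> B b -> (A ⊙ B) (a ⋅ b).
Proof. by move=> Aa Bb; apply/setmulP; exists a, b. Qed.

Lemma setmulS A A' B B' : A `<=` A' -> B `<=` B' -> A ⊙ B `<=` A' ⊙ B'.
Proof.
by move=> AA BB z /setmulP[a [b [/AA ? /BB ? ->]]]; exact: setmul_in.
Qed.

Lemma setmulA A B C : A ⊙ B ⊙ C = A ⊙ (B ⊙ C).
Proof.
apply/seteqP; split=> z /setmulP[x [y []]].
  move=> /setmulP[a [b [Aa Bb ->]]] Cy ->; rewrite gmulA.
  by do 2!apply: setmul_in => //.
move=> Ax /setmulP[b [c [Bb Cc ->]]] ->; rewrite -gmulA.
by do 2!apply: setmul_in => //.
Qed.

Lemma ltransE x A : ltrans x A = [set z | A (inv x ⋅ z)].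
Proof.
apply/seteqP; split=> z /=; first by move=> [a Aa <-]; rewrite gmulKV.
by move=> Az; exists (inv x ⋅ z) => //; rewrite gmulK.
Qed.

Lemma rtransE x A : rtrans A x = [set z | A (z ⋅ inv x)].
Proof.
apply/seteqP; split=> z /=; first by move=> [a Aa <-]; rewrite !lcg_simp.
by move=> Az; exists (z ⋅ inv x) => //; rewrite !lcg_simp.
Qed.

Lemma rtrans_setmul A B x : rtrans (A ⊙ B) x = A ⊙ rtrans B x.
Proof.
apply/seteqP; split=> z /=.
  move=> [_ /setmulP[a [b [Aa Bb ->]]] <-]; rewrite gmulA.
  by apply: setmul_in => //; exists b.
move=> /setmulP[a [_ [Aa [b Bb <-] ->]]]; rewrite -gmulA.
by exists (a ⋅ b) => //; apply: setmul_in.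
Qed.

(** * Topology of the group and small neighbourhoods of the identity *)

Lemma cvg_gmul (x y : G) : (fun p : G * G => p.1 ⋅ p.2) @ (x, y) --> x ⋅ y.
Proof. by case: lcG => [_ H _ _ _]; exact: H (x, y). Qed.

Lemma continuous_ginv : continuous inv.
Proof. by case: lcG. Qed.

Lemma hausG : hausdorff_space G.
Proof. by case: lcG. Qed.

Lemma continuous_gmull x : continuous (mul x).
Proof.
move=> y; apply: (@cvg_comp _ _ _ (fun y => (x, y)) (fun p => p.1 ⋅ p.2));
  last exact: cvg_gmul.
by apply: cvg_pair => //=; exact: cvg_cst.
Qed.

Lemma continuous_gmulr x : continuous (mul^~ x).
Proof.
move=> y; apply: (@cvg_comp _ _ _ (fun y => (y, x)) (fun p => p.1 ⋅ p.2));
  last exact: cvg_gmul.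
by apply: cvg_pair => //=; exact: cvg_cst.
Qed.

Lemma open_rtrans x (A : set G) : open A -> open (rtrans A x).
Proof.
by move=> oA; rewrite rtransE; apply: (@open_comp _ _ (mul^~ (inv x))) => // y _;
  exact: continuous_gmulr.
Qed.

Lemma compact_image (f : G -> G) (A : set G) : continuous f -> compact A -> compact (f @` A).
Proof. by move=> fc; apply: continuous_compact; apply: continuous_subspaceT. Qed.

Lemma compact_ltrans x (A : set G) : compact A -> compact (ltrans x A).
Proof. by apply: compact_image; exact: continuous_gmull. Qed.

Lemma compact_rtrans x (A : set G) : compact A -> compact (rtrans A x).
Proof. by apply: (@compact_image (mul^~ x)); exact: continuous_gmulr. Qed.

Lemma compact_ginv (A : set G) : compact A -> compact (inv @` A).
Proof. by apply: compact_image; exact: continuous_ginv. Qed.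

Lemma compact_setmul (A B : set G) : compact A -> compact B -> compact (A ⊙ B).
Proof.
move=> cA cB; have -> : A ⊙ B = (fun p : G * G => p.1 ⋅ p.2) @` (A `*` B).
  apply/seteqP; split=> z; first by move=> [a Aa [b Bb <-]]; exists (a, b).
  by move=> [[a b] [/= Aa Bb] <-]; apply: setmul_in.
apply: continuous_compact; last exact: compact_setX.
by apply: continuous_subspaceT => -[x y]; exact: cvg_gmul.
Qed.

Lemma compactI (A B : set G) : compact A -> compact B -> compact (A `&` B).
Proof. by move=> cA cB; apply: compact_closedI => //; exact: compact_closed hausG cB. Qed.

(* Compact symmetric neighbourhoods of the identity. *)
Definition csn (P : set G) :=
  [/\ compact P, nbhs e P & forall x, P x -> P (inv x)].

Lemma csn1 P : csn P -> P e.
Proof. by move=> [_ /nbhs_singleton]. Qed.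

Lemma nbhs_ltrans x P : nbhs e P -> nbhs x (ltrans x P).
Proof.
move=> nP; rewrite ltransE.
have := @continuous_gmull (inv x) x; rewrite /continuous_at gmulV; exact.
Qed.

Lemma nbhs_rtrans x P : nbhs e P -> nbhs x (rtrans P x).
Proof.
move=> nP; rewrite rtransE.
have := @continuous_gmulr (inv x) x; rewrite /continuous_at gmulrV; exact.
Qed.

Lemma nbhs_setmul_sub (O : set G) : nbhs e O ->
  exists2 W, nbhs e W & forall x y, W x -> W y -> O (x ⋅ y).
Proof.
move=> nO; have := @cvg_gmul e e; rewrite gmul1 => /(_ _ nO) [[A B] /= [nA nB] AB].
exists (A `&` B); first exact: filterI.
by move=> x y [Ax _] [_ By]; have := AB (x, y); apply.
Qed.

Lemma nbhs_inv (O : set G) : nbhs e O -> nbhs e (inv @^-1` O).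
Proof. by move=> nO; have := @continuous_ginv e; rewrite /continuous_at ginv1; exact. Qed.

Lemma csn_exists (O : set G) : nbhs e O -> exists2 P, csn P & P `<=` O.
Proof.
move=> nO; have [C nC [cC clC]] : exists2 C, nbhs e C & compact C /\ closed C.
  case: lcG => _ _ _ _ /(_ e I) [C].
  by rewrite withinET => nC [cC clC]; exists C.
have [W nW WW] := nbhs_setmul_sub (filterI nO nC).
pose D := W `&` inv @^-1` W.
have nD : nbhs e D by apply: filterI => //; exact: nbhs_inv.
(* If [x D] meets [D] in [y], then [x] is the product of [y] and the inverse of [x^-1 y], both in
   [W]. Hence the closure of [D] stays in [O] and in the compact set [C]. *)
have clD : closure D `<=` O `&` C.
  move=> x /(_ _ (@nbhs_ltrans x _ nD)) [y [[Wy Wiy]]]; rewrite ltransE /= => -[Wz Wiz].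
  have := WW _ _ Wy Wiz; rewrite /= !lcg_simp; exact.
exists (closure D `&` inv @^-1` closure D).
  split.
  - apply: compact_closedI.
      by apply: (subclosed_compact _ cC); [exact: closed_closure|move=> x /clD[]].
    by apply: preimage_closed; [move=> *; exact: continuous_ginv|exact: closed_closure].
  - have nc : nbhs e (closure D) by apply: filterS nD; exact: subset_closure.
    by apply: filterI => //; exact: nbhs_inv.
  - by move=> x [] /= ? ?; split => //=; rewrite ginvK.
by move=> x [/clD[]].
Qed.

Lemma csn_sq (O : set G) : nbhs e O -> exists2 P, csn P & P ⊙ P `<=` O.
Proof.
move=> /nbhs_setmul_sub[W /csn_exists[P cP PW] WO]; exists P => //.
by move=> z /setmulP[x [y [/PW Px /PW Py ->]]]; exact: WO.
Qed.

Lemma csn_sub_sq P : csn P -> P `<=` P ⊙ P.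
Proof. by move=> /csn1 Pe x Px; apply/setmulP; exists e, x; rewrite gmul1. Qed.

(** Tube lemma: compactness of [A] replaces the neighbourhoods of [e] that work near the single
    points of [A] by one that works for all. *)
Lemma csn_setmulr (A O : set G) : compact A -> open O -> A `<=` O ->
  exists2 P, csn P & A ⊙ P `<=` O.
Proof.
move=> /compact_near_coveringP cA oO AO.
have [|P cP PO] := @csn_exists [set p | forall x, A x -> O (x ⋅ p)].
  apply: (cA _ (nbhs e) (fun p x => O (x ⋅ p))) => x Ax.
  have := @cvg_gmul x e; rewrite gmulr1 => /(_ O); apply.
  exact: open_nbhs_nbhs (conj oO (AO _ Ax)).
by exists P => // z /setmulP[x [y [Ax /PO + ->]]]; exact.
Qed.

Lemma csn_setmull (A O : set G) : compact A -> open O -> A `<=` O ->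
  exists2 P, csn P & P ⊙ A `<=` O.
Proof.
move=> /compact_near_coveringP cA oO AO.
have [|P cP PO] := @csn_exists [set p | forall x, A x -> O (p ⋅ x)].
  apply: (cA _ (nbhs e) (fun p x => O (p ⋅ x))) => x Ax.
  have /(_ O) := @cvg_gmul e x; rewrite gmul1 => /(_ _)[].
    exact: open_nbhs_nbhs (conj oO (AO _ Ax)).
  move=> [A1 A2] /= [nA1 nA2] A12.
  by exists (A2, A1) => //= -[y p] [/= ? ?]; have := A12 (p, y); apply.
by exists P => // z /setmulP[x [y [/PO + Ax ->]]]; exact.
Qed.

Lemma compact_borel (A : set G) : compact A -> measurable (A : set (BorelT G)).
Proof. exact: hausdorff_compact_borel hausG. Qed.

Context {R : realType} {m : measure (BorelT G) R}.
Hypothesis hm : haar mul m.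
Hypothesis rm : right_invariant mul m.

(** * Haar measure *)

Definition mr (A : set G) : R := fine (m A).

Lemma haar_lf : locally_finite m. Proof. by case: hm. Qed.

Lemma mrE (A : set G) : compact A -> m A = (mr A)%:E.
Proof. by move=> cA; rewrite fineK// ge0_fin_numE ?haar_lf. Qed.

Lemma mr_ge0 A : 0 <= mr A. Proof. exact: fine_ge0. Qed.

Lemma le_mr (A B : set G) : compact A -> compact B -> A `<=` B -> mr A <= mr B.
Proof.
by move=> cA cB AB; rewrite -lee_fin -!mrE//; apply: le_measure;
  rewrite ?inE//; exact: compact_borel.
Qed.

Lemma mr_ltrans x (A : set G) : compact A -> mr (ltrans x A) = mr A.
Proof. by move=> /compact_borel mA; rewrite /mr; case: hm => ->. Qed.

Lemma mr_rtrans x (A : set G) : compact A -> mr (rtrans A x) = mr A.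
Proof. by move=> /compact_borel mA; rewrite /mr rm. Qed.

Lemma averaging_mr : averaging mr.
Proof. exact: averaging_measure hausG haar_lf. Qed.

Lemma outer_open (A : set G) eps : compact A -> 0 < eps ->
  exists O, [/\ open O, A `<=` O & (m O <= (mr A + eps)%:E)%E].
Proof.
move=> cA e0; case: hm => _ _ _ /(_ A (compact_borel cA)) + _.
rewrite mrE// => mA.
have /ereal_inf_lt[_ [W [oO AO] <-] lt] : (ereal_inf [set m U | U in [set U : set G | open U /\ A `<=` U]]
  < (mr A + eps)%:E)%E by rewrite -mA lte_fin ltrDl.
by exists W; split => //; exact: ltW.
Qed.

(** Discretisation blurs a compact set by a neighbourhood of [e]; outer regularity makes the cost in
    Haar measure arbitrarily small. *)
Lemma outer_r (A : set G) eps : compact A -> 0 < eps ->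
  exists2 P, csn P & mr (A ⊙ P) <= mr A + eps.
Proof.
move=> cA e0; have [W [oO AO mO]] := outer_open cA e0.
have [P cP PO] := csn_setmulr cA oO AO; exists P => //.
have cAP : compact (A ⊙ P) by apply: compact_setmul => //; case: cP.
rewrite -lee_fin -mrE//; apply: le_trans mO; apply: le_measure; rewrite ?inE//.
  exact: compact_borel.
exact: open_borel.
Qed.

Lemma outer_l (A : set G) eps : compact A -> 0 < eps ->
  exists2 P, csn P & mr (P ⊙ A) <= mr A + eps.
Proof.
move=> cA e0; have [W [oO AO mO]] := outer_open cA e0.
have [P cP PO] := csn_setmull cA oO AO; exists P => //.
have cAP : compact (P ⊙ A) by apply: compact_setmul => //; case: cP.
rewrite -lee_fin -mrE//; apply: le_trans mO; apply: le_measure; rewrite ?inE//.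
  exact: compact_borel.
exact: open_borel.
Qed.

Lemma csn_gt0 P : csn P -> 0 < mr P.
Proof.
move=> [cP nP _]; rewrite -lte_fin -mrE//.
case: hm => _ _ /(_ P° (@open_interior _ P)) + _ _ => /(_ (ex_intro _ e nP)) lt.
apply: lt_le_trans lt _; apply: le_measure; rewrite ?inE//.
- by apply: open_borel; exact: open_interior.
- exact: compact_borel.
- exact: interior_subset.
Qed.

(** The last bound admits Borel sets [T], for the exceptional set in [mr_average_upper], which is a
    compact set cut by an open one. *)
Lemma discretize (S : set G) (O : G -> set G) : compact S ->
  (forall s, S s -> nbhs s (O s)) ->
  exists l : seq (R * G),
    [/\ forall p, p \in l -> 0 <= p.1 /\ S p.2,
        \sum_(p <- l) p.1 = mr S,
        forall (P : pred G) (T : set G), compact T ->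
          (forall t, S t -> P t -> O t `&` S `<=` T) ->
          \sum_(p <- l | P p.2) p.1 <= mr T,
        forall (P : pred G) (T : set G), compact T ->
          T `<=` S -> (forall s t, T s -> S t -> O t s -> P t) ->
          mr T <= \sum_(p <- l | P p.2) p.1 &
        forall (P : pred G) (T : set G), measurable (T : set (BorelT G)) ->
          (forall t, S t -> P t -> O t `&` S `<=` T) ->
          ((\sum_(p <- l | P p.2) p.1)%:E <= m T)%E].
Proof.
move=> cS nO; have [l [l0 lup ldown]] :=
  discrete_approx hausG cS (haar_lf cS) nO.
have up (P : pred G) (T : set G) : compact T ->
    (forall t, S t -> P t -> O t `&` S `<=` T) -> \sum_(p <- l | P p.2) p.1 <= mr T.
  by move=> cT PT; rewrite -lee_fin -mrE//; apply: lup => //; exact: compact_borel.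
have down (P : pred G) (T : set G) : compact T ->
    T `<=` S -> (forall s t, T s -> S t -> O t s -> P t) ->
    mr T <= \sum_(p <- l | P p.2) p.1.
  by move=> cT TS PT; rewrite -lee_fin -mrE//; apply: ldown => //; exact: compact_borel.
exists l; split => //; apply/eqP; rewrite eq_le; apply/andP; split.
- by apply: (up predT) => // t _ _ x [].
- by apply: (down predT).
Qed.

(* A discrete version of c m(B) <= \int_B Phi(A s) ds: B is cut into pieces
   contained in right translates V t, so that no Fubini theorem is needed. *)
Lemma average_lower (Phi : set G -> R) (A B V : set G) c :
  averaging Phi -> compact A -> compact B -> csn V ->
  (forall t, B t -> c <= Phi (rtrans A t)) ->
  c * mr B <= mr (V ⊙ (inv @` A)) * Phi (A ⊙ B).
Proof.
move=> [_ sub _] cA cB [cV nV Vi] Phic.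
have [l [l0 lS up _ _]] := discretize cB (fun s _ => nbhs_rtrans s nV).
have cVA : compact (V ⊙ (inv @` A)).
  by apply: compact_setmul => //; exact: compact_ginv cA.
apply: (@le_trans _ _ (\sum_(p <- l) p.1 * Phi (rtrans A p.2))).
  rewrite -lS mulr_sumr big_seq [leRHS]big_seq; apply: ler_sum => p /l0[p0 Bp].
  by rewrite mulrC ler_wpM2l// Phic.
apply: (sub _ (fun t => rtrans A t)) => //.
- by move=> p /l0[].
- by move=> t; exact: compact_rtrans.
- exact: compact_setmul.
- exact: mr_ge0.
- by move=> p /l0[_ Bp] _ [a Aa <-]; exact: setmul_in.
- move=> z _; rewrite -(mr_rtrans z cVA).
  apply: (up (fun t => `[< rtrans A t z >])); first exact: compact_rtrans.
  move=> t _ /asboolP[a Aa <-] _ [[v Vv <-] _].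
  exists (v ⋅ inv a); last by rewrite !lcg_simp.
  by apply: setmul_in => //; exists a.
Qed.

(** * Left-invariant functionals compared with Haar measure *)

Section LeftInvariant.
Context (Phi : set G -> R).
Hypothesis aPhi : averaging Phi.
Hypothesis lPhi : forall x (A : set G), compact A -> Phi (ltrans x A) = Phi A.

(** The sets [t V k] with [t] in [A k] cover each [z] of [A] with weight at least [m (z k) = m k],
    and [Phi] takes the value [Phi (V k)] on all of them. The factor [V] absorbs the distance from a
    sample point to the rest of its piece. *)
Lemma cover_le (A k V : set G) : compact A -> csn k -> csn V ->
  mr k * Phi A <= mr (A ⊙ k) * Phi (V ⊙ k).
Proof.
case: aPhi => _ _ sup cA [ck nk ki] [cV nV Vi].
have cS : compact (A ⊙ k) by exact: compact_setmul.
have cVk : compact (V ⊙ k) by exact: compact_setmul.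
have [l [l0 lS _ down _]] := discretize cS (fun s _ => nbhs_ltrans s nV).
apply: (@le_trans _ _ (\sum_(p <- l) p.1 * Phi (ltrans p.2 (V ⊙ k)))); last first.
  rewrite -lS mulr_suml; apply: ler_sum => p _.
  by rewrite lPhi.
apply: (sup _ (fun t => ltrans t (V ⊙ k))) => //.
- by move=> p /l0[].
- by move=> t; exact: compact_ltrans.
- exact: mr_ge0.
- move=> z Az; rewrite -(mr_ltrans z ck).
  apply: (down (fun t => `[< ltrans t (V ⊙ k) z >])); first exact: compact_ltrans.
    by move=> _ [q kq <-]; exact: setmul_in.
  move=> s t [q kq <-] _ [v Vv eq]; apply/asboolP; exists (v ⋅ inv q).
    by apply: setmul_in => //; exact: ki.
  by rewrite -gmulA eq !lcg_simp.
Qed.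

(** Dual to [cover_le]: the sets [t V k] with [t] in [D] lie in [D V k], and those through [z] have
    [t] in [z k V]; a second [V] pays for the sample points. Together the two lemmas compare the
    values of [Phi] on different sets through one small set [V k]. *)
Lemma pack_le (D k V : set G) : compact D -> csn k -> csn V ->
  mr D * Phi (V ⊙ k) <= mr (k ⊙ V ⊙ V) * Phi (D ⊙ (V ⊙ k)).
Proof.
case: aPhi => _ sub _ cD [ck nk ki] [cV nV Vi].
have cVk : compact (V ⊙ k) by exact: compact_setmul.
have ckVV : compact (k ⊙ V ⊙ V) by do 2!apply: compact_setmul => //.
have [l [l0 lS up _ _]] := discretize cD (fun s _ => nbhs_ltrans s nV).
apply: (@le_trans _ _ (\sum_(p <- l) p.1 * Phi (ltrans p.2 (V ⊙ k)))).
  rewrite -lS mulr_suml; apply: ler_sum => p _.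
  by rewrite lPhi.
apply: (sub _ (fun t => ltrans t (V ⊙ k))) => //.
- by move=> p /l0[].
- by move=> t; exact: compact_ltrans.
- exact: compact_setmul.
- exact: mr_ge0.
- by move=> p /l0[_ Dp] _ [q kq <-]; exact: setmul_in.
- move=> z _; rewrite -(mr_ltrans z ckVV).
  apply: (up (fun t => `[< ltrans t (V ⊙ k) z >])); first exact: compact_ltrans.
  move=> t _ /asboolP[_ /setmulP[v [q [Vv kq ->]]] <-] _ [[w Vw <-] _].
  exists (inv q ⋅ inv v ⋅ w); last by rewrite !lcg_simp.
  by apply: setmul_in => //; apply: setmul_in; auto.
Qed.

End LeftInvariant.

(** Right invariance of [m] makes [B |-> m (B^-1)] left invariant, and by symmetry it takes the
    value [m (k V)] at [V k]. So [cover_le] reads [m k * m (A^-1) <= m (A k) * m (k V)]; [V] shrinks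
    before [k] does. *)
Lemma mr_inv_le (A : set G) : compact A -> mr (inv @` A) <= mr A.
Proof.
move=> cA; pose Phi (B : set G) := mr (inv @` B).
have imI (B : set G) z : (inv @` B) z <-> B (inv z).
  by split=> [[b Bb <-]|Bz]; [rewrite ginvK|exists (inv z); rewrite ?ginvK].
have aPhi : averaging Phi.
  case: averaging_mr => _ sub sup; split=> [B _|l C B c l0 cC cB c0 CB le|l C B c l0 cC cB c0 le].
  - exact: mr_ge0.
  - apply: (sub _ (fun t => inv @` C t)) => //.
    + by move=> t; exact: compact_ginv (cC t).
    + exact: compact_ginv.
    + by move=> p /CB CBp _ [x /CBp Bx <-]; exists x.
    + move=> z /imI/le; apply: le_trans; rewrite le_eqVlt; apply/orP; left; apply/eqP.
      by apply: eq_bigl => p; apply/asboolP/asboolP => /imI.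
  - apply: (sup _ (fun t => inv @` C t)) => //.
    + by move=> t; exact: compact_ginv (cC t).
    + exact: compact_ginv.
    + move=> z /imI/le/le_trans; apply; rewrite le_eqVlt; apply/orP; left; apply/eqP.
      by apply: eq_bigl => p; apply/asboolP/asboolP => /imI.
have lPhi x (B : set G) : compact B -> Phi (ltrans x B) = Phi B.
  move=> cB; rewrite /Phi -(mr_rtrans (inv x) (compact_ginv cB)).
  congr mr; apply/seteqP; split=> z /=.
    by move=> [_ [b Bb <-] <-]; exists (inv b); [exists b|rewrite !lcg_simp].
  by move=> [_ [b Bb <-] <-]; exists (x ⋅ b); [exists b|rewrite !lcg_simp].
apply/ler_addgt0Pr => eps e0.
have [k ck Ak] := outer_r cA e0; apply: le_trans Ak.
have k0 := csn_gt0 ck; rewrite -(ler_pM2l k0).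
have cAk : compact (A ⊙ k) by apply: compact_setmul => //; case: ck.
apply/ler_addgt0Pr => del d0.
(* The summand 1 keeps the denominator positive, and the error multiplied by [mr (A ⊙ k)] is still
   at most [del]. *)
have M0 : 0 < mr (A ⊙ k) + 1 by have := mr_ge0 (A ⊙ k); lra.
have [V cV kV] := @outer_r k (del / (mr (A ⊙ k) + 1)) (let: And3 c _ _ := ck in c) (divr_gt0 d0 M0).
apply: le_trans (cover_le aPhi lPhi cA ck cV) _.
have -> : Phi (V ⊙ k) = mr (k ⊙ V).
  congr mr; apply/seteqP; split=> z.
    move=> /imI/setmulP[v [q [Vv kq eq]]]; rewrite -(ginvK z) eq ginvM.
    by apply: setmul_in; [case: ck => _ _; apply|case: cV => _ _; apply].
  move=> /setmulP[q [v [kq Vv ->]]]; apply/imI; rewrite ginvM.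
  by apply: setmul_in; [case: cV => _ _; apply|case: ck => _ _; apply].
have A0 := mr_ge0 (A ⊙ k).
apply: (@le_trans _ _ (mr (A ⊙ k) * (mr k + del / (mr (A ⊙ k) + 1)))).
  by rewrite ler_wpM2l.
rewrite mulrDr [mr k * _]mulrC lerD2l mulrCA ger_pMr//.
by rewrite ler_pdivrMr// mul1r lerDl.
Qed.

Lemma mr_inv (A : set G) : compact A -> mr (inv @` A) = mr A.
Proof.
move=> cA; apply/eqP; rewrite eq_le mr_inv_le//=.
have -> : mr A = mr (inv @` (inv @` A)).
  congr mr; apply/seteqP; split=> z; last by move=> [_ [b Bb <-] <-]; rewrite ginvK.
  by move=> Az; exists (inv z); [exists z|rewrite ginvK].
by apply: mr_inv_le; exact: compact_ginv cA.
Qed.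

Lemma mr_average_lower (Phi : set G -> R) (A B : set G) c :
  averaging Phi -> compact A -> compact B ->
  (forall t, B t -> c <= Phi (rtrans A t)) -> c * mr B <= mr A * Phi (A ⊙ B).
Proof.
move=> aPhi cA cB Phic; have cAB : compact (A ⊙ B) by exact: compact_setmul.
have cAi : compact (inv @` A) by exact: compact_ginv cA.
have Phi0 : 0 <= Phi (A ⊙ B) by case: aPhi => + _ _; exact.
apply/ler_addgt0Pr => del d0.
have M0 : 0 < Phi (A ⊙ B) + 1 by lra.
have [V cV VA] := outer_l cAi (divr_gt0 d0 M0).
apply: le_trans (average_lower aPhi cA cB cV Phic) _.
apply: le_trans (ler_wpM2r Phi0 VA) _.
rewrite mulrDl mr_inv// lerD2l mulrAC -mulrA ger_pMr//.
by rewrite ler_pdivrMr// mul1r lerDl.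
Qed.

(** * Supports of restricted measures *)

Definition full_support (A : set G) :=
  forall x (W : set G), A x -> open W -> W x -> (0 < m (A `&` W))%E.

(** What is removed is the union [Q] of all open sets that are null in [A], possibly uncountably
    many. Inner regularity is applied to [Q] inside an open set [U] of finite measure: a compact [K]
    that nearly exhausts it is covered by finitely many of the null sets, so [A] meets [Q] in a null
    set. *)
Lemma full_support_exists (A : set G) : compact A ->
  exists B : set G, [/\ compact B, B `<=` A, mr B = mr A & full_support B].
Proof.
move=> cA; pose N : set (set G) := [set W | open W /\ m (A `&` W) = 0%E].
pose Q := \bigcup_(W in N) W.
have oQ : open Q by apply: bigcup_open => W [].
have mA := compact_borel cA.
have [U [oU AU mU]] := outer_open cA ltr01.
have fU : (m (Q `&` U) < +oo)%E.
  apply: le_lt_trans (ltry (mr A + 1)); apply: le_trans mU.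
  by apply: le_measure; rewrite ?inE//; apply: open_borel => //; exact: openI.
have oQU : open (Q `&` U) by exact: openI.
have mQU := open_borel oQU.
have fQU : m (Q `&` U) \is a fin_num by rewrite ge0_fin_numE.
have AQ0 : m (A `&` Q) = 0%E.
  apply/eqP; rewrite eq_le measure_ge0 andbT.
  apply/lee_addgt0Pr => eps e0; rewrite add0e.
  case: hm => _ _ _ _ /(_ _ oQU) msup.
  have /ereal_sup_gt[_ [K [cK KQU] <-] lt] :
      (m (Q `&` U) - eps%:E < ereal_sup [set m K | K in [set K : set G | compact K /\ K `<=` Q `&` U]])%E.
    by rewrite -msup lteBlDr// lteDl// lte_fin.
  have mK := compact_borel cK.
  have AK0 : m (A `&` K) = 0%E.
    have := cK; rewrite compact_cover => /(_ (set G) N id) [].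
    - by move=> W [].
    - by move=> x /KQU[[W NW Wx] _]; exists W.
    - move=> D DN KD; apply/eqP; rewrite eq_le measure_ge0 andbT.
      have -> : (0 = \sum_(W \in [set` D]) m (A `&` W))%E.
        by rewrite fsbig1// => W /DN/set_mem[].
      apply: (@content_sub_fsum _ _ _ m _ [set` D] _ (fun W => A `&` W)) => //.
      + by move=> W /DN/set_mem[oW _]; apply: measurableI => //; exact: open_borel.
      + exact: measurableI.
      + by move=> x [Ax /KD[W DW Wx]]; exists W.
  have -> : A `&` Q = A `&` (Q `&` U).
    by apply/seteqP; split=> x [Ax]; [move=> ?; do !split => //; exact: AU|move=> []].
  apply: (@le_trans _ _ (m (A `&` K) + m ((Q `&` U) `\` K))%E).
    apply: (@le_trans _ _ (m ((A `&` K) `|` ((Q `&` U) `\` K)))).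
      apply: le_measure; rewrite ?inE.
      - exact: measurableI.
      - by apply: measurableU; [exact: measurableI|exact: measurableD].
      - by move=> x [Ax QUx]; have [Kx|nKx] := pselect (K x); [left|right].
    by apply: measureU2; [exact: measurableI|exact: measurableD].
  rewrite AK0 add0e measureD// (_ : (Q `&` U) `&` K = K); last by apply: setIidr.
  apply: (@le_trans _ _ (fine (m (Q `&` U)) - mr K)%:E).
    by rewrite EFinB fineK// -mrE//; exact: lexx.
  by move: lt; rewrite -(fineK fQU) (mrE cK) -!EFinB lte_fin lee_fin; lra.
have cB : compact (A `&` ~` Q) by apply: compact_closedI => //; exact: open_closedC.
have mAB : m A = m (A `&` ~` Q).
  transitivity (m (A `&` ~` Q) + m (A `&` Q))%E; last by rewrite AQ0 adde0.
  by rewrite -setDE; exact: measureDI mA (open_borel oQ).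
exists (A `&` ~` Q); split => //; first by rewrite /mr mAB.
move=> x W [Ax nQx] oW Wx; rewrite lt_neqAle measure_ge0 andbT; apply/eqP => e0.
apply: nQx; exists W => //; split => //.
have mW := open_borel oW; have mQ := open_borel oQ.
apply/eqP; rewrite eq_le measure_ge0 andbT.
rewrite -[leRHS]adde0 [X in (_ <= X + _)%E]e0 -[X in (_ <= _ + X)%E]AQ0.
apply: (@le_trans _ _ (m ((A `&` ~` Q `&` W) `|` (A `&` Q)))).
  apply: le_measure; rewrite ?inE.
  - exact: measurableI.
  - by apply: measurableU; do ?apply: measurableI => //; exact: measurableC.
  - by move=> y [Ay Wy]; have [Qy|nQy] := pselect (Q y); [right|left].
by apply: measureU2; do ?apply: measurableI => //; exact: measurableC.
Qed.

(* The V n are chosen with m (A V n) --> m A. If x = b g is in the intersection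
   of the A V n, with b in A and g in the intersection of the V n, right
   translation by g maps A into that intersection; as m charges A near b, the
   point x cannot lie off A. *)
Lemma full_support_Gdelta (A : set G) : compact A -> full_support A ->
  exists V : nat -> set G, [/\ forall n, csn (V n),
    forall n, V n.+1 ⊙ V n.+1 `<=` V n &
    forall x, (forall n, (A ⊙ V n) x) -> A x].
Proof.
move=> cA sA.
have step (n : nat) (P : {P : set G | csn P}) : {Q : {P : set G | csn P} |
    sval Q ⊙ sval Q `<=` sval P /\ mr (A ⊙ sval Q) <= mr A + n.+1%:R^-1}.
  apply: cid; case: P => P cP /=.
  have [P1 cP1 mP1] := outer_r cA (eps := n.+1%:R^-1) (ltac:(by rewrite invr_gt0)).
  have [|Q cQ QQ] := @csn_sq (P `&` P1).
    by apply: filterI; [case: cP|case: cP1].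
  exists (exist _ Q cQ); split=> /=; first by move=> x /QQ[].
  apply: le_trans mP1; apply: le_mr.
  - by apply: compact_setmul => //; case: cQ.
  - by apply: compact_setmul => //; case: cP1.
  - by apply: setmulS => // x /(csn_sub_sq cQ)/QQ[].
have [P0 cP0 _] := csn_exists (@filterT _ (nbhs e) _).
pose f := fix f n : {P : set G | csn P} :=
  if n is k.+1 then sval (step k (f k)) else exist _ P0 cP0.
pose V n := sval (f n).
have cV n : csn (V n) by rewrite /V; case: (f n).
have VV n : V n.+1 ⊙ V n.+1 `<=` V n by rewrite /V /=; case: (step n (f n)) => ? [].
have mV n : mr (A ⊙ V n.+1) <= mr A + n.+1%:R^-1.
  by rewrite /V /=; case: (step n (f n)) => ? [].
have VS n : V n.+1 `<=` V n.
  by move=> x /(csn_sub_sq (cV _))/VV.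
have VSn k n : (k <= n)%N -> V n `<=` V k.
  move=> /subnK <-; elim: (n - k)%N => [//|j IH]; rewrite addSn.
  exact: subset_trans (VS _) IH.
exists V; split => // x AVx; apply: contrapT => nAx.
have /choice[a aP] : forall n, exists a, A a /\ V n (inv a ⋅ x).
  move=> n; have /setmulP[a [v [Aa Vv ->]]] := AVx n.
  by exists a; rewrite !lcg_simp.
have [b [Ab bcl]] : A `&` cluster (a @ \oo) !=set0.
  by apply: cA; exists 0%N => // n _ /=; case: (aP n).
(* Some [a n] with [n] beyond [k] lies in [b V_(k+1)], so [b^-1 x] is the product of [b^-1 (a n)]
   and [(a n)^-1 x], both in [V_(k+1)]. *)
have Vb k : V k (inv b ⋅ x).
  have [y [[n /= kn <-] /= bVn]] :
      [set a n | n in [set n | (k.+1 <= n)%N]] `&` ltrans b (V k.+1) !=set0.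
    apply: bcl; first by exists k.+1 => // n /= kn; exists n.
    by apply: nbhs_ltrans; case: (cV k.+1).
  have [v Vv eq] := bVn.
  apply: VV; apply/setmulP; exists v, (inv (a n) ⋅ x); split => //.
    by apply: (VSn _ _ kn); case: (aP n).
  by rewrite -eq !lcg_simp.
set g := inv b ⋅ x in Vb.
pose W := ~` A.
have oW : open W by apply: closed_openC; exact: compact_closed hausG cA.
pose W' := rtrans W (inv g).
have oW' : open W' by exact: open_rtrans _ _ oW.
have W'b : W' b by exists x => //; rewrite /g !lcg_simp.
have := sA b W' Ab oW' W'b.
have mAW : measurable (A `&` W' : set (BorelT G)).
  by apply: measurableI; [exact: compact_borel|exact: open_borel].
have fAW : m (A `&` W') \is a fin_num.
  rewrite ge0_fin_numE//; apply: le_lt_trans (haar_lf cA).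
  by apply: le_measure; rewrite ?inE//; exact: compact_borel.
rewrite -(fineK fAW) lte_fin => /ltr_add_invr[k]; rewrite add0r => lek.
suff : fine (m (A `&` W')) <= k.+1%:R^-1 by move=> /(lt_le_trans lek); rewrite ltxx.
rewrite -lee_fin fineK// -(rm g mAW).
have cAV : compact (A ⊙ V k.+1) by apply: compact_setmul => //; case: (cV k.+1).
have mAV := compact_borel cAV; have mA := compact_borel cA.
(* [W'] consists of the points that right translation by [g] carries off [A]; those in [A] land in
   [A V_(k+1)] because [g] lies in [V_(k+1)]. *)
apply: (@le_trans _ _ (m ((A ⊙ V k.+1) `\` A))).
  apply: le_measure; rewrite ?inE.
  - have -> : rtrans (A `&` W') g = rtrans A g `&` W.
      rewrite /W' !rtransE; apply/seteqP; split=> z [] /=; rewrite !lcg_simp => Az Wz;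
        split => //=; rewrite ?lcg_simp//.
    apply: measurableI; last exact: open_borel.
    by apply: compact_borel; exact: compact_rtrans.
  - exact: measurableD.
  - move=> _ [y [Ay [w Ww wy]] <-]; split; first by apply: setmul_in => //; exact: Vb.
    by rewrite -wy !lcg_simp.
rewrite measureD//; last exact: haar_lf _ cAV.
rewrite (_ : _ `&` A = A); last first.
  apply: setIidr => y Ay; apply/setmulP; exists y, e; split => //.
    exact: csn1 (cV _).
  by rewrite !lcg_simp.
apply: (@le_trans _ _ (mr (A ⊙ V k.+1) - mr A)%:E).
  by rewrite EFinB -!mrE//; exact: lexx.
by rewrite lee_fin lerBlDl; exact: mV.
Qed.

(* As nu is not assumed regular, t |-> nu (A t) may fail to be measurable: only
   nu (A V_n t `&` B) --> nu (A t `&` B) is used, which holds because A is the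
   intersection of the A V_n. The set of bad pieces has small measure by
   continuity from above (an Egorov argument). *)
Lemma mr_average_upper (nu : measure (BorelT G) R) (A B : set G) c :
  locally_finite nu -> compact A -> full_support A -> compact B ->
  (forall t, fine (nu (rtrans A t)) <= c) ->
  mr A * fine (nu B) <= c * mr ((inv @` A) ⊙ B).
Proof.
move=> lf cA sA cB nuc.
have [_ _ sup] := averaging_measure hausG lf.
have fnu (C : set G) : compact C -> nu C = (fine (nu C))%:E.
  by move=> cC; rewrite fineK// ge0_fin_numE ?lf.
have le_nu (C D : set G) : compact C -> compact D -> C `<=` D -> fine (nu C) <= fine (nu D).
  move=> cC cD CD; rewrite -lee_fin -!fnu//.
  by apply: le_measure => //; rewrite ?inE; exact: compact_borel.
have [V [cV VV AV]] := full_support_Gdelta cA sA.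
have compV n : compact (V n) by case: (cV n).
have VS n : V n.+1 `<=` V n by move=> x /(csn_sub_sq (cV _))/VV.
have VSn k n : (k <= n)%N -> V n `<=` V k.
  move=> /subnK <-; elim: (n - k)%N => [//|j IH]; rewrite addSn.
  exact: subset_trans (VS _) IH.
have cAV n : compact (A ⊙ V n) by exact: compact_setmul.
pose C n t := rtrans (A ⊙ V n) t `&` B.
have cC n t : compact (C n t).
  by apply: compactI => //; exact: compact_rtrans.
have CB n t : fine (nu (C n t)) <= fine (nu B) by apply: le_nu => // x [].
have c0 : 0 <= c by apply: le_trans (nuc e); exact: fine_ge0.
have cAi : compact (inv @` A) by exact: compact_ginv.
pose S := (inv @` A) ⊙ B; have cS : compact S by exact: compact_setmul.
pose N n t := rtrans (V n)° t.
have oN n t : open (N n t) by apply: open_rtrans _ _ _; exact: open_interior.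
have NV n t x : N n t x -> exists2 v, V n v & x = v ⋅ t.
  by move=> [v /interior_subset Vv <-]; exists v.
apply/ler_addgt0Pr => del d0.
have B0 : 0 <= fine (nu B) by exact: fine_ge0.
have S0 := mr_ge0 S.
(* Covers both errors of the final estimate: [eps * mr S] from the good pieces and [eps * nu B] from
   the bad ones. *)
pose eps := del / (mr S + fine (nu B) + 1).
have M0 : 0 < mr S + fine (nu B) + 1 by lra.
have e0 : 0 < eps by exact: divr_gt0.
pose bad n t := c + eps < fine (nu (C n t)).
(* The set of bad points need not be Borel; the union of open neighbourhoods of them is open, and it
   contains every piece whose sample point is bad. *)
pose T n := \bigcup_(t in [set t | bad n t]) N n t.
have oT n : open (T n) by apply: bigcup_open => t _.
pose E n := S `&` \bigcup_(k in [set k | (n <= k)%N]) T k.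
have mE n : measurable (E n : set (BorelT G)).
  apply: measurableI; first exact: compact_borel.
  by apply: open_borel; apply: bigcup_open => k _.
have E0 : \bigcap_n E n = set0.
  apply/seteqP; split => // s Es.
  pose F j : set (BorelT G) := C j s.
  have mF j : measurable (F j) by apply: compact_borel; exact: cC.
  have capF : \bigcap_j F j `<=` rtrans A s.
    move=> x Fx; rewrite rtransE; apply: AV => n.
    by have [+ _] := Fx n I; rewrite rtransE.
  have FS i j : (i <= j)%N -> F j `<=` F i.
    move=> ij x [+ Bx]; rewrite rtransE => Ax; split => //.
    by rewrite rtransE; move: Ax; apply: setmulS => //; exact: VSn.
  (* One index is lost: for [s = v t] with [v] in [V k], the set [A V_k t] lies in [A V_(k-1) s],
     hence membership in [E j.+1] is used. *)
  have Fbig j : c + eps < fine (nu (F j)).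
    have [Ss [k /= jk [t /= badt /NV[v Vv st]]]] := Es j.+1 I.
    apply: lt_le_trans badt _; apply: le_nu => [||x [+ Bx]]; [exact: cC|exact: cC|].
    rewrite rtransE => /setmulP[a [w [Aa Vw eq]]]; split => //.
    rewrite rtransE /=; apply/setmulP; exists a, (w ⋅ inv v); split => //.
      case: k jk t st Vv Vw eq => // k jk t st Vv Vw eq.
      apply: (VSn j k jk); apply: VV; apply: setmul_in => //.
      by case: (cV k.+1) => _ _; apply.
    by rewrite -gmulA -eq st !lcg_simp.
  have mcapF : measurable (\bigcap_j F j) by apply: bigcap_measurable.
  have cvgF : nu \o F @ \oo --> nu (\bigcap_n F n).
    apply: nonincreasing_cvg_mu => //; first by apply: lf; exact: cC.
    by move=> i j ij; apply/subsetPset; exact: FS.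
  have le1 : ((c + eps)%:E <= nu (\bigcap_n F n))%E.
    apply: (cvge_to_ge cvgF); apply: nearW => j /=.
    by rewrite fnu; [rewrite lee_fin ltW|exact: cC].
  have le2 : (nu (\bigcap_n F n) <= nu (rtrans A s))%E.
    by apply: le_measure; rewrite ?inE//; apply: compact_borel; exact: compact_rtrans.
  have := le_trans le1 le2; rewrite fnu; last exact: compact_rtrans.
  by rewrite lee_fin; have := nuc s; lra.
have [n mEn] : exists n, (m (E n) <= eps%:E)%E.
  have cvgE : m \o E @ \oo --> m (\bigcap_n E n).
    apply: nonincreasing_cvg_mu => //.
    - apply: le_lt_trans (haar_lf cS); apply: le_measure; rewrite ?inE//.
      + exact: compact_borel.
      + by move=> x [].
    - by apply: bigcap_measurable.
    - move=> i j ij; apply/subsetPset => x [Sx [k /= jk Tx]]; split => //.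
      by exists k => //=; exact: leq_trans jk.
  rewrite E0 measure0 in cvgE.
  apply: contrapT => /forallNP mE_gt.
  suff : (eps%:E <= 0 :> \bar R)%E by rewrite lee_fin leNgt e0.
  apply: (cvge_to_ge cvgE); apply: nearW => n /=.
  by apply: ltW; rewrite ltNge; apply/negP; exact: mE_gt.
have nN s : S s -> nbhs s (N n s).
  by move=> _; apply: nbhs_rtrans; apply: nbhs_interior; case: (cV n).
have [l [l0 lS _ down up]] := discretize cS nN.
apply: (@le_trans _ _ (\sum_(p <- l) p.1 * fine (nu (C n p.2)))).
  apply: (sup _ (C n)) => //; [by move=> p /l0[]|exact: mr_ge0|].
  move=> z Bz; rewrite -mr_inv// -(mr_rtrans z cAi).
  apply: (down (fun t => `[< C n t z >])); first exact: compact_rtrans.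
    by move=> _ [x Ax <-]; exact: setmul_in.
  move=> s t [_ [a Aa <-] <-] _ /NV[v Vv eq]; apply/asboolP; split => //.
  rewrite rtransE /=; apply/setmulP; exists a, v; split => //.
  have -> : z = a ⋅ (v ⋅ t) by rewrite -eq !lcg_simp.
  by rewrite !lcg_simp.
(* A good piece is charged [c + eps]; a bad one is charged at most [nu B] more, and the bad pieces
   have total weight at most [eps]. *)
apply: (@le_trans _ _ (\sum_(p <- l) (p.1 * (c + eps) +
    (if bad n p.2 then p.1 * fine (nu B) else 0)))).
  rewrite big_seq [leRHS]big_seq; apply: ler_sum => p /l0[p0 _].
  case: ifPn => [_|]; last by rewrite addr0 -leNgt => ?; exact: ler_wpM2l.
  rewrite -mulrDr; apply: ler_wpM2l => //; apply: le_trans (CB n _) _.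
  by rewrite lerDr; lra.
rewrite big_split /= -mulr_suml lS -big_mkcond /= -mulr_suml.
have le1 : \sum_(p <- l | bad n p.2) p.1 <= eps.
  rewrite -lee_fin; apply: le_trans mEn; apply: (up (bad n)) => // t St bt x [Nx Sx].
  by split => //; exists n => //=; exists t.
have eM : eps * (mr S + fine (nu B) + 1) = del by rewrite divfK// gt_eqF.
have := ler_wpM2r B0 le1; nra.
Qed.

(** * Amenability and expansion *)

Section Counting.
Definition rseparated (U X : set G) := forall x y z,
  X x -> X y -> rtrans U x z -> rtrans U y z -> x = y.

Lemma packing (U X : set G) (F : {fset G}) (T : set G) :
  csn U -> rseparated U X -> [set` F] `<=` X -> compact T ->
  (forall x, x \in F -> rtrans U x `<=` T) -> #|` F|%:R * mr U <= mr T.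
Proof.
move=> [cU _ _] sX FX cT FT.
have [_ sub _] := averaging_mr.
rewrite -[leRHS]mul1r.
have := sub [seq (1, x) | x <- enum_fset F] (fun x => rtrans U x) T 1.
rewrite !big_map /=; under eq_bigr do rewrite mul1r mr_rtrans//.
rewrite big_const_seq iter_addr_0 count_predT mulr_natl; apply => //.
- by move=> p /mapP[x _ ->].
- by move=> t; exact: compact_rtrans.
- by move=> p /mapP[x xF ->]; exact: FT.
move=> z _; rewrite big_map /=.
have [[x [xF xz]]|nz] := pselect (exists x, x \in F /\ rtrans U x z); last first.
  rewrite big_seq_cond big1// => x /andP[xF /asboolP xz].
  by exfalso; apply: nz; exists x.
rewrite (_ : \sum_(_ <- _ | _) _ = \sum_(y <- enum_fset F | y == x) 1 :> R).
  by rewrite -big_filter filter_pred1_uniq ?fset_uniq// big_seq1.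
rewrite big_seq_cond [RHS]big_seq_cond; apply: eq_bigl => y; apply/andP/andP => -[yF].
  by move=> /asboolP yz; split => //; apply/eqP; apply: sX yz xz; exact: FX.
by move=> /eqP ->; split => //; exact/asboolP.
Qed.

Context {U X : set G}.
Hypothesis cU : csn U.
Hypothesis sX : rseparated U X.

Lemma finite_rseparated (Q : set G) : compact Q ->
  finite_set (X `&` Q) /\ #|` fset_set (X `&` Q)|%:R * mr U <= mr (U ⊙ Q).
Proof.
move=> cQ; have cUQ : compact (U ⊙ Q) by apply: compact_setmul => //; case: cU.
have bound (F : {fset G}) : [set` F] `<=` X `&` Q -> #|` F|%:R * mr U <= mr (U ⊙ Q).
  move=> FXQ; apply: (packing cU sX) => //; first by move=> x /FXQ[].
  by move=> x xF _ [u Uu <-]; apply: setmul_in => //; case: (FXQ x).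
have fin : finite_set (X `&` Q).
  apply: contrapT => inf.
  have [F FXQ nF] := infinite_set_fset (Num.truncn (mr (U ⊙ Q) / mr U)).+1 inf.
  have U0 := csn_gt0 cU.
  have := bound F FXQ; rewrite -ler_pdivlMr// => le1.
  have := truncnS_gt (mr (U ⊙ Q) / mr U); rewrite ltNge => /negP[].
  by apply: le_trans le1; rewrite ler_nat.
by split => //; apply: bound; rewrite fset_setK.
Qed.

Definition hits (Y : set G) (A : G -> set G) (y : G) : set G :=
  [set x | Y x /\ A x (y ⋅ inv x)].

(** The sum over [x] in [Y] of the indicators of [A_x x]. As [fset_set] of an infinite set is empty,
    the count is meaningful only under a bound such as [bounded_in]. *)
Definition cnt (Y : set G) (A : G -> set G) (y : G) : R := #|` fset_set (hits Y A y)|%:R.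

Definition bounded_in (Q : set G) (Y : set G) (A : G -> set G) :=
  [/\ compact Q, Y `<=` X & forall x, Y x -> A x `<=` Q].

Lemma hits_sub Q Y A y : bounded_in Q Y A ->
  hits Y A y `<=` X `&` rtrans (inv @` Q) y.
Proof.
move=> [cQ YX AQ] x [Yx Ax]; split; first exact: YX.
by exists (inv (y ⋅ inv x)); [exists (y ⋅ inv x) => //; exact: AQ Ax|rewrite !lcg_simp].
Qed.

Lemma hits_finite Q Y A y : bounded_in Q Y A -> finite_set (hits Y A y).
Proof.
move=> b; apply: sub_finite_set (hits_sub b) _.
have [cQ _ _] := b.
by have [] := @finite_rseparated (rtrans (inv @` Q) y)
  (compact_rtrans (compact_ginv cQ)).
Qed.

Lemma cnt_ge0 Y A y : 0 <= cnt Y A y. Proof. by rewrite ler0n. Qed.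

Lemma le_cnt Q Y Y' A A' y : bounded_in Q Y A -> bounded_in Q Y' A' ->
  Y `<=` Y' -> (forall x, Y x -> A x `<=` A' x) -> cnt Y A y <= cnt Y' A' y.
Proof.
move=> b b' YY AA; rewrite ler_nat; apply: fsubset_leq_card.
rewrite -(fset_set_sub (hits_finite y b) (hits_finite y b')).
by move=> x [Yx Ax]; split; [exact: YY|exact: AA].
Qed.

Lemma cnt_bounded Q Y A y : bounded_in Q Y A -> cnt Y A y <= mr (U ⊙ (inv @` Q)) / mr U.
Proof.
move=> b; have [cQ _ _] := b; have ci := compact_ginv cQ.
have [fin le] := finite_rseparated (compact_rtrans (x := y) ci).
have U0 := csn_gt0 cU; rewrite ler_pdivlMr//.
have cUi : compact (U ⊙ (inv @` Q)) by apply: compact_setmul => //; case: cU.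
rewrite -(mr_rtrans y cUi) rtrans_setmul; apply: le_trans le.
apply: ler_wpM2r; first exact: mr_ge0.
rewrite ler_nat; apply: fsubset_leq_card; rewrite -(fset_set_sub (hits_finite y b) fin).
exact: hits_sub.
Qed.

Lemma sum_indicator (s : seq G) (P : pred G) :
  \sum_(x <- s) (P x)%:R = (size (seq.filter P s))%:R :> R.
Proof.
by rewrite size_filter -sum1_count natr_sum [RHS]big_mkcond; apply: eq_bigr => x _; case: (P x).
Qed.

Lemma cnt_ge Q Y A y (s : seq G) : bounded_in Q Y A -> uniq s ->
  (forall x, x \in s -> Y x) ->
  \sum_(x <- s) (`[< A x (y ⋅ inv x) >])%:R <= cnt Y A y.
Proof.
move=> b us sY; rewrite sum_indicator ler_nat; apply: uniq_leq_size.
  exact: filter_uniq.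
move=> x; rewrite mem_filter => /andP[/asboolP Ax xs].
by rewrite in_fset_set ?inE; [split => //; exact: sY|exact: hits_finite b].
Qed.

Lemma cnt_le Q Y A y (s : seq G) : bounded_in Q Y A ->
  (forall x, hits Y A y x -> x \in s) ->
  cnt Y A y <= \sum_(x <- s) (`[< A x (y ⋅ inv x) >])%:R.
Proof.
move=> b sub; rewrite sum_indicator ler_nat; apply: uniq_leq_size; first exact: fset_uniq.
move=> x; rewrite in_fset_set ?inE; last exact: hits_finite b.
by move=> xh; rewrite mem_filter sub// andbT; apply/asboolP; case: xh.
Qed.

Lemma cntU Q Y Y' A y : bounded_in Q Y A -> bounded_in Q Y' A -> Y `&` Y' = set0 ->
  cnt (Y `|` Y') A y = cnt Y A y + cnt Y' A y.
Proof.
move=> b b' d; rewrite /cnt -natrD -cardfsUI.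
have f := hits_finite y b; have f' := hits_finite y b'.
rewrite -fset_setU// -fset_setI//.
have -> : hits Y A y `&` hits Y' A y = set0.
  by apply/seteqP; split=> // x [[Yx _] [Y'x _]]; rewrite -d.
rewrite fset_set0 cardfs0 addn0; congr (#|` fset_set _|%:R).
apply/seteqP; split=> x; first by move=> [[Yx|Yx] Ax]; [left|right].
by move=> [[Yx Ax]|[Yx Ax]]; split=> //; [left|right].
Qed.

Lemma cnt0 A : cnt set0 A = fun=> 0.
Proof.
apply/funext => y; rewrite /cnt (_ : hits _ _ _ = set0) ?fset_set0 ?cardfs0//.
by apply/seteqP; split=> // x [].
Qed.

Lemma cnt_ltrans g Y A y : cnt Y (fun x => ltrans g (A x)) y = cnt Y A (inv g ⋅ y).
Proof.
have -> : (fun x => ltrans g (A x)) = (fun x => [set z | A x (inv g ⋅ z)]).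
  by apply/funext => x; rewrite ltransE.
by congr (#|` fset_set _|%:R); apply/seteqP; split=> x [Yx /=] Ax;
  split=> //=; rewrite -?gmulA // in Ax *; rewrite gmulA.
Qed.

(** The count is upper semicontinuous: near [y] only finitely many [x] can be hit, and an [x] missed
    at [y] stays missed nearby because [A x] is closed. *)
Lemma measurable_cnt Q Y A : bounded_in Q Y A -> (forall x, Y x -> closed (A x)) ->
  measurable_fun [set: BorelT G] (cnt Y A : BorelT G -> R).
Proof.
move=> b clA; have [cQ YX AQ] := b.
apply: (@measurability _ _ _ _ _ _ (@RGenCInfty.G R)).
  exact: RGenCInfty.measurableE.
move=> _ [_ [a ->] <-]; rewrite setTI.
have -> : (cnt Y A : BorelT G -> R) @^-1` `[a, +oo[%classic = ~` [set y | cnt Y A y < a].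
  apply/seteqP; split=> y /=; rewrite in_itv /= andbT; first by move=> ay; apply/negP; rewrite -leNgt.
  by move=> /negP; rewrite -leNgt.
apply: measurableC; apply: open_borel; rewrite openE => y /= ya.
have [P cP _] := csn_exists (@filterT _ (nbhs e) _).
pose F := fset_set (X `&` rtrans ((inv @` Q) ⊙ P) y).
have cQP : compact (rtrans ((inv @` Q) ⊙ P) y).
  apply: compact_rtrans; apply: compact_setmul; first exact: compact_ginv.
  by case: cP.
have [finF _] := finite_rseparated cQP.
have nP : nbhs y (rtrans P y) by apply: nbhs_rtrans; case: cP.
have nF : nbhs y (\bigcap_(x in [set` F]) [set y' | Y x -> A x (y' ⋅ inv x) -> A x (y ⋅ inv x)]).
  apply: filter_bigI => x _.
  have [[Yx nAx]|H] := pselect (Y x /\ ~ A x (y ⋅ inv x)); last first.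
    apply: filterS filterT => z _ /= Yx _; apply: contrapT => nAx; exact: H.
  have : nbhs y ((mul^~ (inv x)) @^-1` (~` A x)).
    apply: open_nbhs_nbhs; split => //; apply: open_comp; last exact/closed_openC/clA.
    by move=> *; exact: continuous_gmulr.
  by apply: filterS => z /= nAz _ /nAz.
apply: filterS (filterI nP nF) => z [Pz Fz] /=; apply: le_lt_trans ya.
rewrite ler_nat; apply: fsubset_leq_card; rewrite -(fset_set_sub (hits_finite z b) (hits_finite y b)).
move=> x [Yx Ax]; split => //; apply: (Fz x) => //=.
rewrite in_fset_set// inE; split; first exact: YX.
case: Pz => p Pp pz; exists (inv (z ⋅ inv x) ⋅ p); last by rewrite -pz !lcg_simp.
by apply: setmul_in => //; exists (z ⋅ inv x) => //; exact: AQ Ax.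
Qed.

(** * Invariant means of multiplicity functions *)

Context {M : (BorelT G -> R) -> R}.
Hypothesis hM : left_inv_mean mul m M.

Definition nice (f : BorelT G -> R) :=
  measurable_fun [set: BorelT G] f /\ exists C : R, forall x, `|f x| <= C.

Lemma loc_ae_all (P : G -> Prop) : (forall x, P x) -> loc_ae m P.
Proof.
move=> aP; exists set0; split; last by move=> x _.
by split=> [|B _ _]; [exact: measurable0|rewrite set0I measure0].
Qed.

Lemma nice_Linf f : nice f -> Linf m f.
Proof. by move=> [mf [C Cf]]; split => //; exists C; exact: loc_ae_all. Qed.

Lemma nice_cst c : nice (fun=> c).
Proof. by split; [exact: measurable_cst|exists `|c|]. Qed.

Lemma niceD f g : nice f -> nice g -> nice (fun x => f x + g x).
Proof.
move=> [mf [C Cf]] [mg [D Dg]]; split; first exact: measurable_funD.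
by exists (C + D) => x; apply: le_trans (ler_normD _ _) (lerD _ _).
Qed.

Lemma niceZ c f : nice f -> nice (fun x => c * f x).
Proof.
move=> [mf [C Cf]]; split; first exact: measurable_funM.
by exists (`|c| * C) => x; rewrite normrM ler_wpM2l.
Qed.

Lemma meanD f g : nice f -> nice g -> M (fun x => f x + g x) = M f + M g.
Proof. by case: hM => _ [MD _] _ _ _ nf ng; apply: MD; exact: nice_Linf. Qed.

Lemma meanZ c f : nice f -> M (fun x => c * f x) = c * M f.
Proof. by case: hM => _ [_ MZ] _ _ _ nf; apply: MZ; exact: nice_Linf. Qed.

Lemma mean_cst c : M (fun=> c) = c.
Proof.
have -> : (fun=> c) = (fun _ : BorelT G => c * 1) by apply/funext => x; rewrite mulr1.
by rewrite (meanZ c (nice_cst 1)); case: hM => _ _ _ -> _; rewrite mulr1.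
Qed.

Lemma mean_ge0 f : nice f -> (forall x, 0 <= f x) -> 0 <= M f.
Proof.
by case: hM => _ _ Mpos _ _ nf f0; apply: Mpos; [exact: nice_Linf|exact: loc_ae_all].
Qed.

Lemma le_mean f g : nice f -> nice g -> (forall x, f x <= g x) -> M f <= M g.
Proof.
move=> nf ng fg; have nNf := niceZ (- 1) nf.
have : 0 <= M (fun x => g x + - 1 * f x).
  by apply: mean_ge0 => [|x]; [exact: niceD|rewrite mulN1r subr_ge0].
by rewrite meanD// meanZ// mulN1r subr_ge0.
Qed.

Lemma mean_sum (I : eqType) (l : seq I) (w : I -> R) (F : I -> BorelT G -> R) :
  (forall i, i \in l -> nice (F i)) ->
  nice (fun y => \sum_(i <- l) w i * F i y) /\
  M (fun y => \sum_(i <- l) w i * F i y) = \sum_(i <- l) w i * M (F i).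
Proof.
elim: l => [|i l IH] nF.
  rewrite big_nil; have -> : (fun y : BorelT G => \sum_(j <- [::]) w j * F j y) = fun=> 0.
    by apply/funext => y; rewrite big_nil.
  by split; [exact: nice_cst|exact: mean_cst].
have [|nl Ml] := IH; first by move=> j jl; apply: nF; rewrite inE jl orbT.
have ni : nice (F i) by apply: nF; rewrite inE eqxx.
have -> : (fun y : BorelT G => \sum_(j <- i :: l) w j * F j y) =
    (fun y => w i * F i y + \sum_(j <- l) w j * F j y).
  by apply/funext => y; rewrite big_cons.
have nwi := niceZ (w i) ni.
by split; [exact: niceD|rewrite big_cons meanD// meanZ// Ml].
Qed.

Lemma nice_cnt Q Y A : bounded_in Q Y A -> (forall x, Y x -> closed (A x)) ->
  nice (cnt Y A).
Proof.
move=> b clA; split; first exact (measurable_cnt b clA).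
exists (mr (U ⊙ (inv @` Q)) / mr U) => y; rewrite ger0_norm ?ler0n//.
exact (cnt_bounded y b).
Qed.

Definition meancnt (Y A : set G) : R := M (cnt Y (fun=> A)).

Lemma bounded_cst Y A : Y `<=` X -> compact A -> bounded_in A Y (fun=> A).
Proof. by move=> YX cA; split => // x _. Qed.

Lemma nice_cst_cnt Y A : Y `<=` X -> compact A -> nice (cnt Y (fun=> A)).
Proof.
move=> YX cA; apply: (nice_cnt (bounded_cst YX cA)) => x _.
exact: compact_closed hausG cA.
Qed.

(** At each [y] the finite sums over [l] and over the points of [Y] that are hit are exchanged; the
    hypothesis then applies to every [y x^-1], and [M] preserves the pointwise inequality. *)
Lemma averaging_meancnt Y : Y `<=` X -> averaging (meancnt Y).
Proof.
move=> YX; split.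
- by move=> A cA; apply: mean_ge0; [exact: nice_cst_cnt|move=> x; exact: cnt_ge0].
- move=> l C A c l0 cC cA c0 CA le; rewrite /meancnt.
  have [nS <-] := @mean_sum _ l (fun p => p.1) (fun p => cnt Y (fun=> C p.2))
    (fun p _ => nice_cst_cnt YX (cC p.2)).
  rewrite -meanZ; last exact: nice_cst_cnt.
  apply: le_mean => //; first by apply: niceZ; exact: nice_cst_cnt.
  move=> y; set s := fset_set (hits Y (fun=> A) y).
  have fh := hits_finite y (bounded_cst YX cA).
  have sY x : x \in s -> Y x by rewrite in_fset_set// inE => -[].
  apply: (@le_trans _ _ (c * \sum_(x <- s) (`[< A (y ⋅ inv x) >])%:R)); last first.
    apply: ler_wpM2l => //.
    exact (cnt_ge y (bounded_cst YX cA) (fset_uniq s) sY).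
  apply: (@le_trans _ _ (\sum_(p <- l) p.1 * \sum_(x <- s) (`[< C p.2 (y ⋅ inv x) >])%:R)).
    rewrite big_seq [leRHS]big_seq; apply: ler_sum => p pl.
    apply: ler_wpM2l; first exact: l0.
    apply: (cnt_le (bounded_cst YX (cC p.2))) => x [Yx Cx].
    by rewrite in_fset_set// inE; split => //; exact: CA Cx.
  under eq_bigr do rewrite mulr_sumr.
  rewrite exchange_big /= mulr_sumr; apply: ler_sum => x _.
  rewrite (_ : \sum_(p <- l) _ = \sum_(p <- l | `[< C p.2 (y ⋅ inv x) >]) p.1); last first.
    by rewrite [RHS]big_mkcond; apply: eq_bigr => p _; case: asboolP; rewrite ?mulr1 ?mulr0.
  case: asboolP => Ax; first by rewrite mulr1; exact: le.
  rewrite mulr0 big_seq_cond big1// => p /andP[pl /asboolP Cx].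
  by exfalso; apply: Ax; exact: CA Cx.
- move=> l C A c l0 cC cA c0 le; rewrite /meancnt.
  have [nS <-] := @mean_sum _ l (fun p => p.1) (fun p => cnt Y (fun=> C p.2))
    (fun p _ => nice_cst_cnt YX (cC p.2)).
  rewrite -meanZ; last exact: nice_cst_cnt.
  apply: le_mean => //; first by apply: niceZ; exact: nice_cst_cnt.
  move=> y; set s := fset_set (hits Y (fun=> A) y).
  have fh := hits_finite y (bounded_cst YX cA).
  have sY x : x \in s -> Y x by rewrite in_fset_set// inE => -[].
  apply: (@le_trans _ _ (c * \sum_(x <- s) (`[< A (y ⋅ inv x) >])%:R)).
    apply: ler_wpM2l => //.
    apply: (cnt_le (bounded_cst YX cA)) => x xh.
    by rewrite in_fset_set// inE.
  apply: (@le_trans _ _ (\sum_(p <- l) p.1 * \sum_(x <- s) (`[< C p.2 (y ⋅ inv x) >])%:R)); last first.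
    rewrite big_seq [leRHS]big_seq; apply: ler_sum => p pl.
    apply: ler_wpM2l; first exact: l0.
    exact (cnt_ge y (bounded_cst YX (cC p.2)) (fset_uniq s) sY).
  under [leRHS]eq_bigr do rewrite mulr_sumr.
  rewrite exchange_big /= mulr_sumr; apply: ler_sum => x _.
  rewrite (_ : \sum_(p <- l) _ = \sum_(p <- l | `[< C p.2 (y ⋅ inv x) >]) p.1); last first.
    by rewrite [RHS]big_mkcond; apply: eq_bigr => p _; case: asboolP; rewrite ?mulr1 ?mulr0.
  case: asboolP => Ax; first by rewrite mulr1; exact: le.
  by rewrite mulr0 big_seq_cond; apply: sumr_ge0 => p /andP[/l0].
Qed.

Lemma meancnt_ltrans Y g (A : set G) : Y `<=` X -> compact A ->
  meancnt Y (ltrans g A) = meancnt Y A.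
Proof.
move=> YX cA; rewrite /meancnt.
have -> : cnt Y (fun=> ltrans g A) = (fun y => cnt Y (fun=> A) (inv g ⋅ y)).
  by apply/funext => y; exact: (cnt_ltrans g Y (fun=> A) y).
by case: hM => _ _ _ _; apply; apply: nice_Linf; exact: nice_cst_cnt.
Qed.

(* As for the uniqueness of Haar measure, both sides are compared with a small
   neighbourhood V k; the constant is uniform in g and Y. *)
Lemma meancnt_rtrans Y g : Y `<=` X ->
  meancnt Y (U ⊙ U) <= 2 * mr (U ⊙ U ⊙ U) / mr U * meancnt Y (rtrans (U ⊙ U) g).
Proof.
move=> YX; have aJ := averaging_meancnt YX.
have lJ x (A : set G) : compact A -> meancnt Y (ltrans x A) = meancnt Y A.
  exact: meancnt_ltrans.
have [compU nU _] := cU; have U0 := csn_gt0 cU.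
(* Conjugation by [g] keeps [k k] inside [U], so that [U g (V k)] is contained in [U U g]. *)
have [k ck kk] : exists2 P, csn P & P ⊙ P `<=` [set p | U (g ⋅ (p ⋅ inv g))] `&` U.
  apply: csn_sq; apply: filterI => //.
  have n1 : nbhs (g ⋅ (e ⋅ inv g)) U by rewrite !lcg_simp.
  have c1 := @continuous_gmulr (inv g) e.
  have c2 := @continuous_gmull g (e ⋅ inv g).
  exact: (c1 _ (c2 _ n1)).
have [compk nk _] := ck; have k0 := csn_gt0 ck.
(* With [mr k] itself as the error, [m (k W)] is at most [2 * mr k]: the origin of the factor 2. *)
have [W cW kW] := outer_r compk k0.
have [V cV VV] : exists2 V, csn V & V ⊙ V `<=` W `&` k.
  by apply: csn_sq; apply: filterI => //; case: cW.
have [compV nV _] := cV.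
have VVk : V `<=` k by move=> x /(csn_sub_sq cV)/VV[].
have kU : k `<=` U by move=> x /(csn_sub_sq ck)/kk[].
have cUU : compact (U ⊙ U) by exact: compact_setmul.
have cUUk : compact (U ⊙ U ⊙ k) by exact: compact_setmul.
have cUUU : compact (U ⊙ U ⊙ U) by exact: compact_setmul.
have cVk : compact (V ⊙ k) by exact: compact_setmul.
have cD : compact (rtrans U g) by exact: compact_rtrans.
have cDVk : compact (rtrans U g ⊙ (V ⊙ k)) by exact: compact_setmul.
have cR : compact (rtrans (U ⊙ U) g) by exact: compact_rtrans.
have J0 (A : set G) : compact A -> 0 <= meancnt Y A by case: aJ => + _ _; exact.
have le1 := cover_le aJ lJ cUU ck cV.
have le2 := pack_le aJ lJ cD ck cV.
have le3 : mr (U ⊙ U ⊙ k) <= mr (U ⊙ U ⊙ U) by apply: le_mr => //; exact: setmulS.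
have le4 : mr (k ⊙ V ⊙ V) <= 2 * mr k.
  have -> : 2 * mr k = mr k + mr k by ring.
  apply: le_trans kW; apply: le_mr.
  - by do 2!apply: compact_setmul => //.
  - by apply: compact_setmul => //; case: cW.
  - by rewrite setmulA; apply: setmulS => // x /VV[].
have le5 : meancnt Y (rtrans U g ⊙ (V ⊙ k)) <= meancnt Y (rtrans (U ⊙ U) g).
  apply: le_mean; try exact: nice_cst_cnt.
  move=> y; apply: (le_cnt y (Q := (rtrans U g ⊙ (V ⊙ k)) `|` rtrans (U ⊙ U) g)).
  - by split => [||x _]; [exact: compactU|exact: YX|exact: subsetUl].
  - by split => [||x _]; [exact: compactU|exact: YX|exact: subsetUr].
  - by [].
  - move=> x _ z /setmulP[_ [q [[u Uu <-] VKq ->]]].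
    have [Uq _] : ([set p | U (g ⋅ (p ⋅ inv g))] `&` U) q.
      by apply: kk; move: VKq; apply: setmulS.
    exists (u ⋅ (g ⋅ (q ⋅ inv g))); last by rewrite !lcg_simp.
    exact: setmul_in.
rewrite mr_rtrans// in le2.
have a0 := mr_ge0 (U ⊙ U ⊙ U).
have b0 := J0 _ cVk; have d0 := J0 _ cR; have f0 := J0 _ cDVk.
have le6 : mr k * meancnt Y (U ⊙ U) <= mr (U ⊙ U ⊙ U) * meancnt Y (V ⊙ k).
  by apply: le_trans le1 _; exact: ler_wpM2r.
have le7 : mr U * meancnt Y (V ⊙ k) <= 2 * mr k * meancnt Y (rtrans (U ⊙ U) g).
  apply: le_trans le2 _; apply: (@le_trans _ _ (2 * mr k * meancnt Y (rtrans U g ⊙ (V ⊙ k)))).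
    exact: ler_wpM2r.
  by apply: ler_wpM2l => //; lra.
have Uk0 : 0 < mr U * mr k by exact: mulr_gt0.
rewrite -(ler_pM2l Uk0).
have -> : mr U * mr k * (2 * mr (U ⊙ U ⊙ U) / mr U * meancnt Y (rtrans (U ⊙ U) g)) =
  mr (U ⊙ U ⊙ U) * (2 * mr k * meancnt Y (rtrans (U ⊙ U) g)).
  by field; rewrite gt_eqF.
rewrite -[leLHS]mulrA; apply: le_trans (ler_wpM2l (ltW U0) le6) _.
by rewrite mulrCA; exact: ler_wpM2l.
Qed.

(** [Y] is split according to a translate [U g] containing [gamma x]. On each part [meancnt_rtrans]
    applies with the same constant, and [U U g] lies in [U U U (gamma x)]; since there are finitely
    many parts, additivity of [M] suffices. *)
Lemma meancnt_pieces (L : set G) (gamma : G -> G) : compact L ->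
  (forall x, X x -> L (gamma x)) ->
  forall (gs : seq G) (Y : set G), Y `<=` X ->
  (forall x, Y x -> exists2 g, g \in gs & rtrans U g (gamma x)) ->
  meancnt Y (U ⊙ U) <=
    2 * mr (U ⊙ U ⊙ U) / mr U * M (cnt Y (fun x => rtrans (U ⊙ U ⊙ U) (gamma x))).
Proof.
move=> cL Lg; have [compU nU Ui] := cU.
have cUU : compact (U ⊙ U) by exact: compact_setmul.
have cUUU : compact (U ⊙ U ⊙ U) by exact: compact_setmul.
have k0 : 0 <= 2 * mr (U ⊙ U ⊙ U) / mr U.
  by do ?[apply: mulr_ge0|apply: mr_ge0]; rewrite ?invr_ge0 ?mr_ge0.
have bnd (Y : set G) : Y `<=` X ->
    bounded_in (U ⊙ U ⊙ U ⊙ L) Y (fun x => rtrans (U ⊙ U ⊙ U) (gamma x)).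
  move=> YX; split => [||x Yx _ [u Uu <-]]; [exact: compact_setmul|exact: YX|].
  by apply: setmul_in => //; apply: Lg; exact: YX.
have nic (Y : set G) : Y `<=` X -> nice (cnt Y (fun x => rtrans (U ⊙ U ⊙ U) (gamma x))).
  move=> YX; apply: (nice_cnt (bnd _ YX)) => x _.
  by apply: compact_closed hausG _; exact: compact_rtrans.
elim=> [|g gs IH] Y YX Ygs.
  have -> : Y = set0 by apply/seteqP; split => // x /Ygs[].
  by rewrite /meancnt !cnt0 mean_cst mulr0.
pose Y0 := Y `&` [set x | rtrans U g (gamma x)].
pose Y1 := Y `&` ~` [set x | rtrans U g (gamma x)].
have Y0X : Y0 `<=` X by move=> x [/YX].
have Y1X : Y1 `<=` X by move=> x [/YX].
have YE : Y = Y0 `|` Y1 by rewrite /Y0 /Y1 -setIUr setUv setIT.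
have Y01 : Y0 `&` Y1 = set0 by apply/seteqP; split => // x [[_ a] [_ b]].
have M1 : meancnt Y (U ⊙ U) = meancnt Y0 (U ⊙ U) + meancnt Y1 (U ⊙ U).
  rewrite /meancnt -meanD; try exact: nice_cst_cnt.
  congr (M _); apply/funext => y; rewrite YE.
  exact: (cntU y (bounded_cst Y0X cUU) (bounded_cst Y1X cUU)).
have M2 : M (cnt Y (fun x => rtrans (U ⊙ U ⊙ U) (gamma x))) =
    M (cnt Y0 (fun x => rtrans (U ⊙ U ⊙ U) (gamma x))) +
    M (cnt Y1 (fun x => rtrans (U ⊙ U ⊙ U) (gamma x))).
  rewrite -meanD; try exact: nic.
  congr (M _); apply/funext => y; rewrite YE.
  exact: (cntU y (bnd _ Y0X) (bnd _ Y1X)).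
rewrite M1 M2 mulrDr; apply: lerD; last first.
  apply: IH => // x [Yx nx]; have [h] := Ygs _ Yx.
  by rewrite inE => /orP[/eqP -> //|hgs] ?; exists h.
apply: le_trans (meancnt_rtrans g Y0X) _; apply: ler_wpM2l => //.
apply: le_mean; [by apply: nice_cst_cnt => //; exact: compact_rtrans|exact: nic|].
move=> y; have cR : compact (rtrans (U ⊙ U) g) by exact: compact_rtrans.
have [cB _ _] := bnd _ Y0X.
apply: (le_cnt y (Q := rtrans (U ⊙ U) g `|` (U ⊙ U ⊙ U ⊙ L))).
- by split => [||x _]; [exact: compactU|exact: Y0X|exact: subsetUl].
- split => [||x Yx]; [exact: compactU|exact: Y0X|].
  by have [_ _ /(_ x Yx)] := bnd _ Y0X; move=> sub z /sub; right.
- by [].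
- move=> x [_ [u Uu ug]] z [w UUw <-].
  exists (w ⋅ inv u); last by rewrite -ug !lcg_simp.
  by apply: setmul_in => //; exact: Ui.
Qed.

(* The tau _ i carry X onto n disjoint subsets of X by displacements in L; each
   copy has mean at least mr U / (2 mr (U U U)), and their total multiplicity is
   bounded. *)
Lemma matching_bound n (L : set G) (tau : G -> 'I_n -> G) :
  compact L -> (forall y, exists x, X x /\ rtrans (U ⊙ U) x y) ->
  (forall x i, X x -> X (tau x i) /\ L (tau x i ⋅ inv x)) ->
  (forall x i x' i', X x -> X x' -> tau x i = tau x' i' -> x = x' /\ i = i') ->
  n%:R <= 2 * mr (U ⊙ U ⊙ U) / mr U * (mr (U ⊙ (U ⊙ U ⊙ U)) / mr U).
Proof.
move=> cL Xcov Xtau tau_inj; have [compU nU Ui] := cU.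
have U0 := csn_gt0 cU.
have cUU : compact (U ⊙ U) by exact: compact_setmul.
have cUUU : compact (U ⊙ U ⊙ U) by exact: compact_setmul.
have cUUUU : compact (U ⊙ (U ⊙ U ⊙ U)) by exact: compact_setmul.
(* With this displacement, [A i x] translated by [x] is [U U U (tau x i)], so [cnt X (A i)] counts
   points of the copy [tau _ i] of [X]. *)
pose gamma i x := tau x i ⋅ inv x.
pose A i x := rtrans (U ⊙ U ⊙ U) (gamma i x).
have bnd i : bounded_in (U ⊙ U ⊙ U ⊙ L) X (A i).
  split => [||x Xx _ [u Uu <-]] //; first exact: compact_setmul.
  by apply: setmul_in => //; case: (Xtau x i Xx).
have nic i : nice (cnt X (A i)).
  apply: (nice_cnt (bnd i)) => x _.
  by apply: compact_closed hausG _; exact: compact_rtrans.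
have [gs Lgs] : exists gs : seq G, forall z, L z -> exists2 g, g \in gs & rtrans U g z.
  have := cL; rewrite compact_cover => /(_ G setT (fun g => rtrans U° g)) [].
  - by move=> g _; apply: open_rtrans; exact: open_interior.
  - by move=> z Lz; exists z => //; exists e => //; rewrite !lcg_simp.
  - move=> D _ LD; exists (enum_fset D) => z /LD[g gD [u /interior_subset Uu eq]].
    by exists g => //; exists u.
have one_le i : 1 <= 2 * mr (U ⊙ U ⊙ U) / mr U * M (cnt X (A i)).
  apply: (@le_trans _ _ (meancnt X (U ⊙ U))).
    (* The sets [U U x] cover [G], so the multiplicity is at least 1 everywhere. *)
    rewrite -[leLHS]mean_cst; apply: le_mean; [exact: nice_cst|exact: nice_cst_cnt|].
    move=> y; rewrite ler1n cardfs_gt0; apply/fset0Pn.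
    have [x [Xx [u Uu uy]]] := Xcov y; exists x.
    rewrite in_fset_set ?inE; last exact (hits_finite y (bounded_cst (@subset_refl _ X) cUU)).
    by split => //; rewrite -uy !lcg_simp.
  apply: (meancnt_pieces cL _ _) => //; first by move=> x Xx; case: (Xtau x i Xx).
  by move=> x Xx; apply: Lgs; case: (Xtau x i Xx).
have k0 : 0 <= 2 * mr (U ⊙ U ⊙ U) / mr U.
  by do ?[apply: mulr_ge0|apply: mr_ge0]; rewrite ?invr_ge0 ?mr_ge0.
have -> : n%:R = \sum_(i <- enum 'I_n) 1 :> R.
  by rewrite big_enum sumr_const card_ord.
apply: (@le_trans _ _ (\sum_(i <- enum 'I_n) 2 * mr (U ⊙ U ⊙ U) / mr U * M (cnt X (A i)))).
  by apply: ler_sum => i _; exact: one_le.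
rewrite -mulr_sumr; apply: ler_wpM2l => //.
have [nS MS] := @mean_sum _ (enum 'I_n) (fun=> 1) (fun i => cnt X (A i)) (fun i _ => nic i).
under eq_bigr do rewrite -[M _]mul1r.
rewrite -MS -[leRHS]mean_cst; apply: le_mean => //; first exact: nice_cst.
move=> y; under eq_bigr do rewrite mul1r.
pose H i := hits X (A i) y.
have fH i : finite_set (H i) by exact (hits_finite y (bnd i)).
have cR : compact (rtrans (U ⊙ U ⊙ U) y) by exact: compact_rtrans.
have [finF leF] := finite_rseparated cR.
rewrite ler_pdivlMr// -(mr_rtrans y cUUUU) rtrans_setmul.
apply: le_trans leF; apply: ler_wpM2r; first exact: mr_ge0.
rewrite -natr_sum ler_nat.
(* The counted pairs give distinct points of [X], all in [U U U y]; packing bounds their number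
   independently of [y]. *)
pose s := [seq tau x i | i <- enum 'I_n, x <- enum_fset (fset_set (H i))].
have -> : (\sum_(i <- enum 'I_n) #|` fset_set (H i)|)%N = size s.
  by rewrite size_allpairs_dep sumnE big_map.
apply: uniq_leq_size.
  apply: allpairs_uniq_dep; first exact: enum_uniq.
    by move=> i _; exact: fset_uniq.
  move=> [i x] [j x'] /allpairsPdep[i0 [x0 [_ x0H [-> ->]]]].
  move=> /allpairsPdep[j0 [x1 [_ x1H [-> ->]]]] /= eq.
  move: x0H x1H; rewrite !in_fset_set// !inE => -[Xx0 _] [Xx1 _].
  by have [-> ->] := tau_inj _ _ _ _ Xx0 Xx1 eq.
move=> z /allpairsPdep[i [x [_ + ->]]]; rewrite !in_fset_set// !inE => -[Xx [u UUUu uy]].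
split; first by case: (Xtau x i Xx).
exists (inv u).
  case: UUUu => _ /setmulP[a [b [Ua Ub ->]]] [c Uc <-].
  rewrite !lcg_simp -gmulA; apply: setmul_in; last exact: Ui.
  by apply: setmul_in; exact: Ui.
have -> : y = u ⋅ gamma i x ⋅ x by rewrite uy !lcg_simp.
by rewrite /gamma !lcg_simp.
Qed.

End Counting.

(** * Maximal separated sets and the Hall condition *)

Lemma maximal_rseparated (U : set G) : csn U ->
  exists X, rseparated U X /\ forall y, exists x, X x /\ rtrans (U ⊙ U) x y.
Proof.
move=> [_ /nbhs_singleton Ue Ui].
have [F FP Ftot|X [sX maxX]] := @Zorn_bigcup G (rseparated U).
  move=> x y z [A FA Ax] [B FB By].
  have [AB|BA] := Ftot _ _ FA FB.
    by apply: (FP _ FB) => //; exact: AB.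
  by apply: (FP _ FA) => //; exact: BA.
exists X; split => // y; apply: contrapT => ny.
have far x z : X x -> rtrans U x z -> rtrans U y z -> False.
  move=> Xx [u Uu uz] [v Vv vz]; apply: ny; exists x; split => //.
  exists (inv v ⋅ u); first by apply: setmul_in => //; exact: Ui.
  by rewrite gmulA uz -vz !lcg_simp.
have nXy : ~ X y.
  by move=> Xy; apply: ny; exists y; split => //; exists (e ⋅ e);
    [exact: setmul_in|rewrite !lcg_simp].
apply: (maxX (X `|` [set y])).
  split; first exact: subsetUl.
  by move=> /(_ y) H; apply: nXy; apply: H; right.
move=> a b z [Xa|->] [Xb|->] // az bz; first exact: sX az bz.
- by exfalso; exact: far az bz.
- by exfalso; exact: far bz az.
Qed.

Lemma covering (W : set G) (F : {fset G}) (T : set G) : compact W -> compact T ->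
  (forall z, T z -> exists2 x, x \in F & rtrans W x z) -> mr T <= #|` F|%:R * mr W.
Proof.
move=> cW cT Tcov; have [_ _ sup] := averaging_mr.
rewrite -[leLHS]mul1r.
have := sup [seq (1, x) | x <- enum_fset F] (fun x => rtrans W x) T 1.
rewrite !big_map /=; under eq_bigr do rewrite mul1r mr_rtrans//.
rewrite big_const_seq iter_addr_0 count_predT mulr_natl; apply => //.
- by move=> p /mapP[x _ ->].
- by move=> t; exact: compact_rtrans.
move=> z /Tcov[x xF xz]; rewrite big_map /=.
have -> : \sum_(y <- enum_fset F | `[< rtrans W y z >]) 1 =
    (count (fun y => `[< rtrans W y z >]) (enum_fset F))%:R :> R.
  by rewrite -sum1_count natr_sum.
rewrite ler1n -has_count.
by apply/hasP; exists x => //; exact/asboolP.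
Qed.

Lemma amenable_no_expansion : amenable mul m ->
  ~ forall C : R, exists2 K, cK K & forall A : set G, cKp m A -> C * mr A <= mr (K ⊙ A).
Proof.
move=> [M hM] expand.
have [U cU _] := csn_exists (@filterT _ (nbhs e) _).
have [compU nU Ui] := cU; have Ue := csn1 cU; have U0 := csn_gt0 cU.
have cUU : compact (U ⊙ U) by exact: compact_setmul.
have [X [sX Xcov]] := maximal_rseparated cU.
set b := 2 * mr (U ⊙ U ⊙ U) / mr U * (mr (U ⊙ (U ⊙ U ⊙ U)) / mr U).
(* An integer above the bound of [matching_bound]. *)
pose n := (Num.truncn b).+1.
(* The factor [m (U U) / m U] is the loss between points and sets: [m (U Y)] is at least
   [#|Y| * m U], while [m (K U Y)] is at most [#|nbhd N J| * m (U U)]. *)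
have [K [cptK neK] Kexp] := expand (n%:R * (mr (U ⊙ U) / mr U)).
(* Chosen so that [k u y = v w x] places [x] in [L y]: the net points needed to cover [K U y] are
   neighbours of [y]. *)
pose L := U ⊙ U ⊙ K ⊙ U.
have cL : compact L by do ?apply: compact_setmul.
have finL x : finite_set (X `&` rtrans L x).
  by have [] := finite_rseparated cU sX (compact_rtrans (x := x) cL).
pose I : choiceType := ({x : G | x \in X} * 'I_n)%type.
pose N (p : I) := fset_set (X `&` rtrans L (val p.1)).
have hN : hall N.
  move=> J; pose Y : {fset G} := [fset val (p : I).1 | p in J]%fset.
  have YX : [set` Y] `<=` X.
    by move=> x /imfsetP[p /= _ ->]; apply: set_mem; exact: (valP p.1).
  have JY : (#|` J| <= #|` Y| * n)%N.
    have -> : (#|` Y| * n)%N = size [seq (x, i) | x <- enum_fset Y, i <- enum 'I_n].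
      by rewrite size_allpairs size_enum_ord.
    rewrite -(size_map (fun p : I => (val p.1, p.2)) (enum_fset J)).
    apply: uniq_leq_size.
      rewrite map_inj_uniq; first exact: fset_uniq.
      by move=> [x i] [y j] /= [/val_inj -> ->].
    move=> q /mapP[p pJ ->]; apply/allpairsP; exists (val p.1, p.2) => /=.
    by split => //; [apply/imfsetP; exists p|rewrite mem_enum].
  apply: leq_trans JY _.
  (* The empty case is set apart because [U Y] must belong to [cKp m]. *)
  have [Y0|Ypos] := posnP #|` Y|; first by rewrite Y0 mul0n.
  have cY : compact [set` Y] by apply: finite_compact; exact: finite_fset.
  have cUY : compact (U ⊙ [set` Y]) by exact: compact_setmul.
  have cKUY : compact (K ⊙ (U ⊙ [set` Y])) by exact: compact_setmul.
  have UYm : #|` Y|%:R * mr U <= mr (U ⊙ [set` Y]).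
    apply: (packing cU sX) => // x xY _ [u Uu <-].
    exact: setmul_in.
  have UYpos : 0 < mr (U ⊙ [set` Y]).
    by apply: lt_le_trans UYm; rewrite mulr_gt0 ?ltr0n.
  have UYKp : cKp m (U ⊙ [set` Y]).
    split => //; split; last by rewrite mrE// lte_fin.
    have [y yY] : exists y, y \in Y by apply/fset0Pn; rewrite -cardfs_gt0.
    by exists (e ⋅ y); exact: setmul_in.
  have up : mr (K ⊙ (U ⊙ [set` Y])) <= #|` nbhd N J|%:R * mr (U ⊙ U).
    apply: covering => // z /setmulP[k [_ [Kk /setmulP[u [y [Uu yY ->]]] ->]]].
    have [x [Xx xz]] := Xcov (k ⋅ (u ⋅ y)); exists x => //.
    have /imfsetP[p /= pJ yp] := yY.
    apply/nbhdP; exists p => //; rewrite in_fset_set// inE; split => //.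
    case: xz => _ /setmulP[v [w [Uv Uw ->]]] eq.
    exists (inv (v ⋅ w) ⋅ k ⋅ u).
      apply: setmul_in => //; apply: setmul_in => //; rewrite ginvM.
      by apply: setmul_in; exact: Ui.
    by apply: (gcancel (x := v ⋅ w)); rewrite eq yp !lcg_simp.
  have := le_trans (Kexp _ UYKp) up.
  have UU0 : 0 < mr (U ⊙ U).
    by apply: lt_le_trans U0 _; apply: le_mr => // x /(csn_sub_sq cU).
  have c0 : 0 <= n%:R * (mr (U ⊙ U) / mr U) by rewrite mulr_ge0 ?divr_ge0 ?mr_ge0.
  move=> /(le_trans (ler_wpM2l c0 UYm)).
  have -> : n%:R * (mr (U ⊙ U) / mr U) * (#|` Y|%:R * mr U) = (#|` Y| * n)%:R * mr (U ⊙ U).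
    by rewrite natrM; field; rewrite gt_eqF.
  by rewrite ler_pM2r// ler_nat.
have [f finj fN] := hall_marriage hN.
pose tau x (i : 'I_n) : G :=
  if pselect (X x) is left Xx then f (exist _ x (mem_set Xx), i) else x.
have tauE x i (Xx : X x) : tau x i = f (exist _ x (mem_set Xx), i).
  by rewrite /tau; case: pselect => // Xx'; congr (f (_, _)); apply: val_inj.
have : n%:R <= b; last by rewrite leNgt truncnS_gt.
apply: (matching_bound cU sX hM cL (tau := tau)) => //.
  move=> x i Xx; rewrite (tauE _ _ Xx).
  have := fN (exist _ x (mem_set Xx), i); rewrite in_fset_set// inE => -[Xf Lf].
  by split => //; move: Lf; rewrite rtransE.
move=> x i y j Xx Xy; rewrite (tauE _ _ Xx) (tauE _ _ Xy) => /finj.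
by move=> /(congr1 (fun p : I => (val p.1, p.2))) /= [-> ->].
Qed.

(** * Densities *)

Section Densities.
Context {nu : measure (BorelT G) R}.
Hypothesis lf : locally_finite nu.
Local Notation nr A := (fine (nu A)).

Lemma nuE (A : set G) : compact A -> nu A = (nr A)%:E.
Proof. by move=> cA; rewrite fineK// ge0_fin_numE ?lf. Qed.

Lemma eratio_nu (A B : set G) : compact A -> eratio (nu A) (m B) = (nr A / mr B)%:E.
Proof. by move=> cA; rewrite /eratio nuE// -EFinM. Qed.

Lemma eratio_m (A B : set G) : compact A -> eratio (m A) (m B) = (mr A / mr B)%:E.
Proof. by move=> cA; rewrite /eratio mrE// -EFinM. Qed.

Lemma cKp_gt0 (A : set G) : cKp m A -> 0 < mr A.
Proof. by move=> [cA [_ +]]; rewrite mrE// lte_fin. Qed.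

Lemma le_mr_setmul (K A : set G) : cK K -> compact A -> mr A <= mr (K ⊙ A).
Proof.
move=> [cptK [k Kk]] cA; rewrite -(mr_ltrans k cA); apply: le_mr.
- exact: compact_ltrans.
- exact: compact_setmul.
- by move=> _ [a Aa <-]; exact: setmul_in.
Qed.

Lemma cKp_setmul (K A : set G) : cK K -> cKp m A -> cKp m (K ⊙ A).
Proof.
move=> cKK cA; have [cptA [[a Aa] _]] := cA; have [cptK [k Kk]] := cKK.
have cKA : compact (K ⊙ A) by exact: compact_setmul.
split => //; split; first by exists (k ⋅ a); exact: setmul_in.
by rewrite mrE// lte_fin; apply: lt_le_trans (cKp_gt0 cA) _; exact: le_mr_setmul.
Qed.

Lemma cKp_rtrans s (A : set G) : cKp m A -> cKp m (rtrans A s).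
Proof.
move=> cA; have [cptA [[a Aa] _]] := cA; have cR := compact_rtrans (x := s) cptA.
split => //; split; first by exists (a ⋅ s), a.
by rewrite mrE// lte_fin mr_rtrans//; exact: cKp_gt0.
Qed.

Lemma cK_setmul (K L : set G) : cK K -> cK L -> cK (K ⊙ L).
Proof.
move=> [cptK [k Kk]] [cptL [l Ll]]; split; first exact: compact_setmul.
by exists (k ⋅ l); exact: setmul_in.
Qed.

Lemma cKp_nonempty : exists A : set G, cKp m A.
Proof.
have [P cP _] := csn_exists (@filterT _ (nbhs e) _).
have [cptP _ _] := cP; have P0 := csn_gt0 cP; exists P; split => //; split; first by exists e; exact: csn1 cP.
by rewrite mrE// lte_fin.
Qed.

Lemma ereal_inf_real (T : Type) (D : set T) (f : T -> R) :
  D !=set0 -> (forall t, D t -> 0 <= f t) ->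
  exists r : R, [/\ ereal_inf [set (f t)%:E | t in D] = r%:E, 0 <= r,
    forall t, D t -> r <= f t & forall c, (forall t, D t -> c <= f t) -> c <= r].
Proof.
move=> [t0 Dt0] f0; set I := ereal_inf _.
have I0 : (0 <= I)%E by apply: le_ereal_inf_tmp => _ [t Dt <-]; rewrite lee_fin f0.
have lb t : D t -> (I <= (f t)%:E)%E by move=> Dt; apply: ereal_inf_lbound; exists t.
have fI : I \is a fin_num by rewrite ge0_fin_numE//; exact: le_lt_trans (lb _ Dt0) (ltry _).
exists (fine I); rewrite fineK//; split => //; first exact: fine_ge0.
- by move=> t Dt; rewrite -lee_fin fineK// lb.
- move=> c cf; rewrite -lee_fin fineK//; apply: le_ereal_inf_tmp => _ [t Dt <-].
  by rewrite lee_fin cf.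
Qed.

Definition expansion (K A : set G) : R := mr (K ⊙ A) / mr A.

Lemma leptin_inv_term K : cK K -> exists r : R,
  [/\ ereal_inf [set eratio (m (K ⊙ A)) (m A) | A in cKp m] = r%:E,
      1 <= r, (r%:E <= leptin_inv mul m)%E,
      forall A, cKp m A -> r <= expansion K A &
      forall x u, 0 <= u -> (forall A, cKp m A -> x <= u * expansion K A) -> x <= u * r].
Proof.
move=> cKK; have cptK : compact K by case: cKK.
have := @ereal_inf_real _ (cKp m) (expansion K) cKp_nonempty.
have -> : [set (expansion K t)%:E | t in cKp m] =
    [set eratio (m (K ⊙ A)) (m A) | A in cKp m].
  apply/seteqP; split=> _ [A cA <-]; exists A => //; rewrite eratio_m//;
    by apply: compact_setmul => //; case: cA.
case=> [A cA|r [rE r0 rlb rglb]]; first by rewrite divr_ge0 ?mr_ge0.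
exists r; split => //.
- apply: rglb => A cA; have [cptA _] := cA.
  by rewrite ler_pdivlMr ?cKp_gt0// mul1r le_mr_setmul.
- by rewrite -rE; apply: ereal_sup_ubound; exists K.
- move=> x u; rewrite le_eqVlt => /orP[/eqP <-|u0] H.
    have [A cA] := cKp_nonempty; have := H A cA; by rewrite !mul0r.
  rewrite mulrC -ler_pdivrMr//; apply: rglb => A cA.
  by rewrite ler_pdivrMr// mulrC; exact: H.
Qed.

Lemma leptin_inv_ge1 : (1 <= leptin_inv mul m)%E.
Proof.
have c1 : cK [set e] by split; [exact: compact_set1|exists e].
have [r [_ r1 rI _ _]] := leptin_inv_term c1.
by apply: le_trans rI; rewrite lee_fin.
Qed.

Lemma beurling_le_leptin_lower : (beurling_lower mul m nu <= leptin_lower mul m nu)%E.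
Proof.
apply: ge_ereal_sup => _ [A cA <-]; have [cptA [neA _]] := cA; have A0 := cKp_gt0 cA.
apply: (@le_trans _ _ (ereal_inf [set eratio (nu (A ⊙ B)) (m B) | B in cKp m])); last first.
  by apply: ereal_sup_ubound; exists A.
have -> : [set eratio (nu (rtrans A s)) (m A) | s in [set: G]] =
    [set (nr (rtrans A s) / mr A)%:E | s in [set: G]].
  by congr (image setT _); apply/funext => s; rewrite eratio_nu//; exact: compact_rtrans.
have [||r [-> r0 rlb _]] := @ereal_inf_real _ [set: G] (fun s => nr (rtrans A s) / mr A).
- by exists e.
- by move=> s _; rewrite divr_ge0 ?mr_ge0// fine_ge0.
apply: le_ereal_inf_tmp => _ [B cB <-]; have [cptB _] := cB; have B0 := cKp_gt0 cB.
rewrite eratio_nu; last exact: compact_setmul.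
rewrite lee_fin ler_pdivlMr// -(ler_pM2l A0) mulrA [mr A * r]mulrC.
apply: (mr_average_lower (averaging_measure hausG lf) cptA cptB) => t _.
by rewrite -ler_pdivlMr//; exact: rlb.
Qed.

Lemma leptin_lower_term K : cK K -> exists x : R,
  [/\ ereal_inf [set eratio (nu (K ⊙ A)) (m A) | A in cKp m] = x%:E, 0 <= x &
      forall A, cKp m A -> x <= nr (K ⊙ A) / mr A].
Proof.
move=> cKK; have cptK : compact K by case: cKK.
have -> : [set eratio (nu (K ⊙ A)) (m A) | A in cKp m] =
    [set (nr (K ⊙ A) / mr A)%:E | A in cKp m].
  apply/seteqP; split=> _ [A cA <-]; exists A => //; rewrite eratio_nu//;
    by apply: compact_setmul => //; case: cA.
have [||x [-> x0 xlb _]] := @ereal_inf_real _ (cKp m) (fun A => nr (K ⊙ A) / mr A).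
- exact: cKp_nonempty.
- by move=> A _; rewrite divr_ge0 ?mr_ge0// fine_ge0.
by exists x.
Qed.

Lemma leptin_le_beurling_lower :
  (leptin_lower mul m nu <= beurling_lower mul m nu * leptin_inv mul m)%E.
Proof.
apply: ge_ereal_sup => _ [K cKK <-]; have [cptK _] := cKK.
have [x [-> x0 xlb]] := leptin_lower_term cKK.
have [r [_ r1 rI _ rglb]] := leptin_inv_term cKK.
have b_ge A : cKp m A -> ((x / expansion K A)%:E <= beurling_lower mul m nu)%E.
  move=> cA; have cKA := cKp_setmul cKK cA; have [cptKA _] := cKA; have [cptA _] := cA.
  have A0 := cKp_gt0 cA; have KA0 := cKp_gt0 cKA.
  apply: (@le_trans _ _ (ereal_inf [set eratio (nu (rtrans (K ⊙ A) s)) (m (K ⊙ A)) | s in [set: G]])).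
    apply: le_ereal_inf_tmp => _ [s _ <-].
    rewrite eratio_nu; last exact: compact_rtrans.
    rewrite lee_fin /expansion invf_div mulrA; apply: ler_wpM2r; first by rewrite invr_ge0 ltW.
    rewrite -ler_pdivlMr// rtrans_setmul.
    by have := xlb _ (cKp_rtrans s cA); rewrite mr_rtrans.
  by apply: ereal_sup_ubound; exists (K ⊙ A).
have eK A : cKp m A -> 0 < expansion K A.
  by move=> cA; rewrite divr_gt0// cKp_gt0//; exact: cKp_setmul.
have [A0 cA0] := cKp_nonempty.
have b0 : (0 <= beurling_lower mul m nu)%E.
  by apply: le_trans (b_ge _ cA0); rewrite lee_fin divr_ge0// ltW// eK.
have I0 : (0 < leptin_inv mul m)%E by exact: lt_le_trans leptin_inv_ge1.
(* If the Beurling density is infinite, so is the product, because [leptin_inv] is at least 1. *)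
move: b0 b_ge; case: (beurling_lower mul m nu) => [b b0 b_ge| |//]; last first.
  by move=> _ _; rewrite gt0_mulye// leey.
(* The real [r] below [leptin_inv] is used first, so the bound survives when [b] is 0 and
   [leptin_inv] is infinite, the product then being 0. *)
apply: (@le_trans _ _ (b%:E * r%:E)%E); last by rewrite lee_wpmul2l.
rewrite -EFinM lee_fin; apply: rglb => // A cA.
by rewrite -ler_pdivrMr ?eK// -lee_fin; exact: b_ge.
Qed.

Lemma leptin_upper_term K : cK K ->
  (0 <= ereal_sup [set eratio (nu A) (m (K ⊙ A)) | A in cKp m])%E /\
  forall A, cKp m A -> ((nr A / mr (K ⊙ A))%:E <=
    ereal_sup [set eratio (nu A) (m (K ⊙ A)) | A in cKp m])%E.
Proof.
move=> cKK.
have ub A : cKp m A -> ((nr A / mr (K ⊙ A))%:E <=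
    ereal_sup [set eratio (nu A) (m (K ⊙ A)) | A in cKp m])%E.
  by move=> cA; have [cptA _] := cA; apply: ereal_sup_ubound; exists A => //; rewrite eratio_nu.
split => //; have [A cA] := cKp_nonempty; apply: le_trans (ub _ cA).
by rewrite lee_fin divr_ge0 ?mr_ge0// fine_ge0.
Qed.

Lemma beurling_le_leptin_upper :
  (einv (leptin_inv mul m) * beurling_upper mul m nu <= leptin_upper mul m nu)%E.
Proof.
apply: le_ereal_inf_tmp => _ [K cKK <-].
have [u0 uub] := leptin_upper_term cKK.
have [r [_ r1 + _ rglb]] := leptin_inv_term cKK.
have : (1 <= leptin_inv mul m)%E := leptin_inv_ge1.
(* An infinite [leptin_inv] has inverse 0, which makes the left side 0 even for an infinite Beurling
   density. *)
case: (leptin_inv mul m) => [i i1 ri|_ _|//]; last by rewrite mul0e.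
rewrite [einv _]/=.
have i0 : 0 < i by rewrite -lte_fin; exact: lt_le_trans i1.
move: u0 uub; case: (ereal_sup _) => [u u0 uub|_ _|//]; last by rewrite leey.
have bub A : cKp m A -> (beurling_upper mul m nu <= (u * expansion K A)%:E)%E.
  move=> cA; have [cptA _] := cA; have A0 := cKp_gt0 cA.
  have KA0 := cKp_gt0 (cKp_setmul cKK cA).
  apply: (@le_trans _ _ (ereal_sup [set eratio (nu (rtrans A s)) (m A) | s in [set: G]])).
    by apply: ereal_inf_lbound; exists A.
  apply: ge_ereal_sup => _ [s _ <-]; rewrite eratio_nu; last exact: compact_rtrans.
  have := uub _ (cKp_rtrans s cA); rewrite !lee_fin -rtrans_setmul mr_rtrans; last first.
    by apply: compact_setmul => //; case: cKK.
  rewrite ler_pdivrMr// => H; rewrite ler_pdivrMr// /expansion.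
  by rewrite -mulrA divfK// gt_eqF.
move: bub; case: (beurling_upper mul m nu) => [b bub|bub|_].
- rewrite lee_fin in u0; rewrite lee_fin in ri.
  rewrite -EFinM lee_fin mulrC ler_pdivrMr//.
  apply: le_trans (ler_wpM2l u0 ri); apply: rglb => [|A cA]; first exact: u0.
  by have := bub _ cA; rewrite lee_fin.
- by have [A cA] := cKp_nonempty; have := bub _ cA.
- by rewrite gt0_muleNy ?leNye// lte_fin invr_gt0.
Qed.

Lemma leptin_le_beurling_upper : (leptin_upper mul m nu <= beurling_upper mul m nu)%E.
Proof.
apply: le_ereal_inf_tmp => _ [A cA <-]; have [cptA _] := cA; have A0 := cKp_gt0 cA.
have cR s : compact (rtrans A s) by exact: compact_rtrans.
have ub s : ((nr (rtrans A s) / mr A)%:E <=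
    ereal_sup [set eratio (nu (rtrans A s)) (m A) | s in [set: G]])%E.
  by apply: ereal_sup_ubound; exists s => //; rewrite eratio_nu.
move: ub; case: (ereal_sup _) => [c ub|_|/(_ e)//]; last by rewrite leey.
(* Passing to [B] preserves the Haar measure and can only lower [nu] of the translates, so the bound
   by [c] is kept. *)
have [B [cptB BA mB sB]] := full_support_exists cptA.
have neB : B !=set0.
  apply/set0P/eqP => B0; move: A0; rewrite -mB B0 /mr measure0 ltxx.
  by [].
have cKi : cK (inv @` B).
  by split; [exact: compact_ginv|case: neB => b Bb; exists (inv b), b].
apply: (@le_trans _ _ (ereal_sup [set eratio (nu C) (m ((inv @` B) ⊙ C)) | C in cKp m])).
  by apply: ereal_inf_lbound; exists (inv @` B).
apply: ge_ereal_sup => _ [C cC <-]; have [cptC _] := cC.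
rewrite eratio_nu// lee_fin ler_pdivrMr; last by apply: cKp_gt0; exact: cKp_setmul.
rewrite -(ler_pM2l A0) -{1}mB mulrA [mr A * c]mulrC.
apply: (mr_average_upper lf cptB sB cptC) => t.
apply: (@le_trans _ _ (nr (rtrans A t))); last first.
  by rewrite -ler_pdivrMr// -lee_fin; exact: ub.
rewrite -lee_fin -!nuE//; last exact: compact_rtrans.
apply: le_measure; rewrite ?inE; [apply: compact_borel; exact: compact_rtrans|exact: compact_borel|].
by move=> _ [b Bb <-]; exists b => //; exact: BA.
Qed.

Lemma amenable_leptin_inv : amenable mul m -> leptin_inv mul m = 1%E.
Proof.
move=> am; apply/eqP; rewrite eq_le leptin_inv_ge1 andbT leNgt; apply/negP => gt1.
apply: (amenable_no_expansion am) => C.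
have [_ [K cKK <-]] := ereal_sup_gt gt1.
have [r [-> _ _ rlb _]] := leptin_inv_term cKK; rewrite lte_fin => r1.
(* The bound [r] holds for every set in [cKp m], hence also for [K A], so the factors multiply under
   iteration. *)
have pow n : exists2 L, cK L & forall A, cKp m A -> r ^+ n * mr A <= mr (L ⊙ A).
  elim: n => [|n [L cL IH]].
    exists K => // A cA; rewrite expr0 mul1r; have [cptA _] := cA.
    exact: le_mr_setmul.
  exists (L ⊙ K); first exact: cK_setmul.
  move=> A cA; rewrite setmulA; apply: le_trans (IH _ (cKp_setmul cKK cA)).
  rewrite exprSr -mulrA; apply: ler_wpM2l; first by rewrite exprn_ge0//; lra.
  by rewrite -ler_pdivlMr ?cKp_gt0//; exact: rlb.
have bern n : 1 + n%:R * (r - 1) <= r ^+ n.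
  elim: n => [|n IH]; first by rewrite mul0r addr0 expr0.
  have r0 : 0 <= r by lra.
  rewrite exprS -natr1; apply: le_trans (ler_wpM2l r0 IH).
  have : 0 <= n%:R * ((r - 1) * (r - 1)) :> R by rewrite mulr_ge0// mulr_ge0//; lra.
  lra.
pose n := (Num.truncn (`|C| / (r - 1))).+1.
have Cn : C <= r ^+ n.
  apply: le_trans (bern n); have : `|C| / (r - 1) < n%:R by exact: truncnS_gt.
  rewrite ltr_pdivrMr ?subr_gt0// => ?; have := ler_norm C; lra.
have [L cL Lexp] := pow n; exists L => // A cA; apply: le_trans (Lexp _ cA).
by apply: ler_wpM2r => //; exact: mr_ge0.
Qed.

(** For [K] and [L] in [cK], [nu (K A) / m A] is the product of [nu (K A) / m (L K A)], bounded by
    the upper term for [L], and of the expansion of [A] by [L K], whose infimum over [A] is at most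
    [leptin_inv], that is 1. *)
Lemma leptin_lower_le_upper : leptin_inv mul m = 1%E ->
  (leptin_lower mul m nu <= leptin_upper mul m nu)%E.
Proof.
move=> I1; apply: ge_ereal_sup => _ [K cKK <-]; apply: le_ereal_inf_tmp => _ [L cL <-].
have [x [-> x0 xlb]] := leptin_lower_term cKK.
have [u0 uub] := leptin_upper_term cL.
move: u0 uub; case: (ereal_sup _) => [u u0 uub|_ _|//]; last by rewrite leey.
have [r [_ _ + _ rglb]] := leptin_inv_term (cK_setmul cL cKK).
rewrite I1 !lee_fin => r1.
apply: (@le_trans _ _ (u * r)); last by rewrite -[leRHS]mulr1 ler_wpM2l.
apply: rglb => // A cA; apply: le_trans (xlb _ cA) _.
have cKA := cKp_setmul cKK cA.
rewrite /expansion mulrA ler_wpM2r ?invr_ge0 ?mr_ge0// setmulA.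
rewrite -ler_pdivrMr -?lee_fin; first exact: uub.
by apply: cKp_gt0; exact: cKp_setmul.
Qed.

End Densities.

End Group.

Local Open Scope ereal_scope.

Theorem theorem4p3 (R : realType) (G : ptopologicalType)
  (mul : G -> G -> G) (inv : G -> G) (e : G)
  (m nu : measure (BorelT G) R) :
  lc_group mul inv e ->
  haar mul m ->
  right_invariant mul m ->
  locally_finite nu ->
  [/\ beurling_lower mul m nu <= leptin_lower mul m nu,
      leptin_lower mul m nu <= beurling_lower mul m nu * leptin_inv mul m,
      einv (leptin_inv mul m) * beurling_upper mul m nu <= leptin_upper mul m nu,
      leptin_upper mul m nu <= beurling_upper mul m nu &
      (amenable mul m ->
        [/\ beurling_lower mul m nu = leptin_lower mul m nu,
            leptin_lower mul m nu <= leptin_upper mul m nu &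
            leptin_upper mul m nu = beurling_upper mul m nu])].
Proof.
move=> lcG hm rm lf.
have lower_le := beurling_le_leptin_lower lcG hm rm lf.
have le_lower := leptin_le_beurling_lower lcG hm rm lf.
have upper_le := beurling_le_leptin_upper lcG hm rm lf.
have le_upper := leptin_le_beurling_upper lcG hm rm lf.
split => // am; have I1 := amenable_leptin_inv lcG hm rm am.
split.
- by apply/eqP; rewrite eq_le lower_le /= -[leRHS]mule1 -I1.
- exact (leptin_lower_le_upper lcG hm lf I1).
- apply/eqP; rewrite eq_le le_upper /=; move: upper_le.
  by rewrite I1 /= invr1 mul1e.
Qed.
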